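(* Let $\Omega\subset\mathbb{R}^2$ be a bounded simply connected domain with Lipschitz boundary, and let $\epsilon\in L^2(\mathcal{S}^2;\Omega)$ be an elastic strain field, under plane-strain or plane-stress conditions, satisfying equilibrium and the zero boundary traction condition. Extend $\epsilon$ by zero to $\mathbb{R}^2$ and let ${}^s\epsilon$ be its solenoidal part. Then $\epsilon$ is recovered from ${}^s\epsilon$ by $$\epsilon_{11}={}^s\epsilon_{11}-\frac{\nu}{1-\nu}\,{}^s\epsilon_{22},\qquad \epsilon_{22}={}^s\epsilon_{22}-\frac{\nu}{1-\nu}\,{}^s\epsilon_{11},\qquad \epsilon_{12}=\frac{1}{1-\nu}\,{}^s\epsilon_{12}$$ for plane-strain, and $$\epsilon_{11}={}^s\epsilon_{11}-\nu\,{}^s\epsilon_{22},\qquad \epsilon_{22}={}^s\epsilon_{22}-\nu\,{}^s\epsilon_{11},\qquad \epsilon_{12}=(1+\nu)\,{}^s\epsilon_{12}$$ for plane-stress.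
   Context: All indices run over $\{1,2\}$; repeated indices are summed. $L^2(\mathcal{S}^2;U)$ is the space of square-integrable symmetric $2$-tensor fields on $U$. $E>0$ (Young's modulus) and $\nu\in(-1,\tfrac12)$ (Poisson's ratio) are constants; the stress is $\sigma_{ij}=C_{ijkl}\epsilon_{kl}$ with $$C_{ijkl}=\frac{E}{1+\nu}\Big(\frac{\nu}{1-2\nu}\delta_{ij}\delta_{kl}+\tfrac12(\delta_{ik}\delta_{jl}+\delta_{il}\delta_{jk})\Big)\ \text{(plane-strain)},$$ $$C_{ijkl}=\frac{E}{1+\nu}\Big(\frac{\nu}{1-\nu}\delta_{ij}\delta_{kl}+\tfrac12(\delta_{ik}\delta_{jl}+\delta_{il}\delta_{jk})\Big)\ \text{(plane-stress)}.$$ Equilibrium ($\partial_j\sigma_{ij}=0$ in $\Omega$) and zero boundary traction ($\sigma\cdot n=0$ on $\partial\Omega$, $n$ the outward normal) are understood together weakly: $\int_\Omega\sigma_{ij}\,\partial_j\varphi_i\,dx=0$ for all $\varphi\in H^1(\Omega;\mathbb{R}^2)$. Solenoidal part: every $\epsilon\in L^2(\mathcal{S}^2;\mathbb{R}^2)$ is uniquely $\epsilon=d\omega+{}^s\epsilon$ with $(d\omega)_{ij}=\tfrac12(\partial_j\omega_i+\partial_i\omega_j)$, $\omega$ in the closure of smooth compactly supported vector fields in the norm $\|d\omega\|_{L^2}$, and ${}^s\epsilon\in L^2(\mathcal{S}^2;\mathbb{R}^2)$ with $\partial_j({}^s\epsilon)_{ij}=0$ in the distributional sense on $\mathbb{R}^2$.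 *)

(* Defs.v *)
From HB Require Import structures.
From mathcomp Require Import all_boot all_order all_algebra.
From mathcomp Require Import all_classical all_reals all_analysis.
Set Implicit Arguments.
Unset Strict Implicit.
Unset Printing Implicit Defensive.
Import Order.TTheory GRing.Theory Num.Theory.
Import numFieldNormedType.Exports.
Local Open Scope classical_set_scope.
Local Open Scope ring_scope.

(* The plane is [R * R].  Tensor fields take values in
   ['M[R]_2] and vector fields in ['rV[R]_2]; the indices 1, 2 of the mathematics
   are the elements 0, 1 of ['I_2].  Elements of L^2 are represented by
   measurable functions, and equality in L^2 is equality almost everywhere. *)

Definition leb2 (R : realType) :
    {measure set (measurableTypeR R * measurableTypeR R) -> \bar R} :=
  (@lebesgue_measure R \x @lebesgue_measure R)%E.

Section PlaneCalculus.
Variable R : realType.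
Implicit Types (Omega D : set (R * R)) (f g psi : R * R -> R).

Definition basis2 (i : 'I_2) : R * R := if i == 0 then (1, 0) else (0, 1).

Definition partial (i : 'I_2) f : R * R -> R := 'D_(basis2 i) f.

Fixpoint class_C (n : nat) f : Prop :=
  if n is m.+1 then
    continuous f /\
    forall i, (forall x, derivable f x (basis2 i)) /\ class_C m (partial i f)
  else continuous f.

Definition smooth f : Prop := forall n, class_C n f.

(* C_c^oo(Omega) *)
Definition test_function Omega psi : Prop :=
  [/\ smooth psi, compact (closure [set x | psi x != 0]) &
      closure [set x | psi x != 0] `<=` Omega].

(* L^2(D), for D measurable: the extension by zero of f is in L^2(R^2). *)
Definition L2 D f : Prop := f \_ D \in Lfun (leb2 R) 2%:E.

Definition L2_sym_tensor D (A : R * R -> 'M[R]_2) : Prop :=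
  (forall x, D x -> (A x)^T = A x) /\ forall i j, L2 D (fun x => A x i j).

Definition weak_partial Omega (j : 'I_2) f g : Prop :=
  forall psi, test_function Omega psi ->
    \int[leb2 R]_(x in Omega) (f x * partial j psi x) =
    - \int[leb2 R]_(x in Omega) (g x * psi x).

(* phi is in H^1(Omega; R^2) and G i j is its weak derivative d_j phi_i. *)
Definition H1_with_gradient Omega
    (phi : R * R -> 'rV[R]_2) (G : R * R -> 'M[R]_2) : Prop :=
  forall i, L2 Omega (fun x => phi x 0 i) /\
    forall j, L2 Omega (fun x => G x i j) /\
      weak_partial Omega j (fun x => phi x 0 i) (fun x => G x i j).

End PlaneCalculus.

Section Domains.
Variable R : realType.
Implicit Types Omega : set (R * R).

Definition boundary Omega := closure Omega `\` interior Omega.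

(* Every loop in Omega is null-homotopic in Omega relative to its base point;
   path-connectedness is part of [lipschitz_sc_domain] below (an open connected
   subset of the plane is path-connected). *)
Definition loops_contract Omega : Prop :=
  forall gamma : R -> R * R,
    {within `[0, 1], continuous gamma} -> gamma 0 = gamma 1 ->
    (forall t : R, t \in `[0, 1] -> Omega (gamma t)) ->
  exists H : R * R -> R * R,
    [/\ {within `[0, 1] `*` `[0, 1], continuous H},
        forall r t : R, r \in `[0, 1] -> t \in `[0, 1] -> Omega (H (r, t)),
        forall t : R, t \in `[0, 1] -> H (0, t) = gamma t,
        forall t : R, t \in `[0, 1] -> H (1, t) = gamma 0 &
        forall r : R, r \in `[0, 1] -> H (r, 0) = gamma 0 /\ H (r, 1) = gamma 0].

(* Near each boundary point z, in the orthonormal frame (c, d), (-d, c) centred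
   at z, Omega is the strict epigraph of a Lipschitz function. *)
Definition lipschitz_boundary Omega : Prop :=
  forall z, boundary Omega z ->
  exists (c d k : R) (h : R -> R),
    [/\ c ^+ 2 + d ^+ 2 = 1, k.-lipschitz h &
        \forall y \near z,
          Omega y <->
          h (c * (y.1 - z.1) + d * (y.2 - z.2)) <
            - d * (y.1 - z.1) + c * (y.2 - z.2)].

Definition lipschitz_sc_domain Omega : Prop :=
  [/\ open Omega, Omega !=set0, connected Omega &
      [/\ bounded_set Omega, loops_contract Omega & lipschitz_boundary Omega]].

End Domains.

Section Elasticity.
Variable R : realType.
Implicit Types (Omega : set (R * R)) (A : R * R -> 'M[R]_2).

Local Notation delta i j := ((i == j)%:R : R).

Definition plane_strain_C (E nu : R) (i j k l : 'I_2) : R :=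
  E / (1 + nu) * (nu / (1 - 2 * nu) * (delta i j * delta k l) +
    2^-1 * (delta i k * delta j l + delta i l * delta j k)).

Definition plane_stress_C (E nu : R) (i j k l : 'I_2) : R :=
  E / (1 + nu) * (nu / (1 - nu) * (delta i j * delta k l) +
    2^-1 * (delta i k * delta j l + delta i l * delta j k)).

Definition stress (C : 'I_2 -> 'I_2 -> 'I_2 -> 'I_2 -> R) (eps : R * R -> 'M[R]_2)
    : R * R -> 'M[R]_2 :=
  fun x => \matrix_(i, j) \sum_k \sum_l C i j k l * eps x k l.

(* Weak form of: div sigma = 0 in Omega and sigma n = 0 on the boundary. *)
Definition traction_free_equilibrium Omega (sigma : R * R -> 'M[R]_2) : Prop :=
  forall phi G, H1_with_gradient Omega phi G ->
    \int[leb2 R]_(x in Omega) (\sum_i \sum_j sigma x i j * G x i j) = 0.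

Definition ext0 Omega A : R * R -> 'M[R]_2 := patch (fun=> 0) Omega A.

Definition test_field (w : R * R -> 'rV[R]_2) : Prop :=
  forall i, test_function setT (fun x => w x 0 i).

Definition sym_grad (w : R * R -> 'rV[R]_2) : R * R -> 'M[R]_2 :=
  fun x => \matrix_(i, j)
    (2^-1 * (partial j (fun y => w y 0 i) x + partial i (fun y => w y 0 j) x)).

Definition L2_norm A : \bar R :=
  'N[leb2 R]_2%:E [ (fun x : R * R => (Num.sqrt (\sum_i \sum_j A x i j ^+ 2))%:E) ].

(* P = d omega for some omega in the closure of the smooth compactly supported
   fields in the norm |d omega|_{L^2}.  Such an omega is the class of a sequence
   w of test fields that is Cauchy for this norm, and d omega is by definition
   the L^2 limit of d (w n); the convergence below entails the Cauchy property. *)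
Definition potential_tensor (P : R * R -> 'M[R]_2) : Prop :=
  L2_sym_tensor setT P /\
  exists w : nat -> R * R -> 'rV[R]_2,
    (forall n, test_field (w n)) /\
    L2_norm (fun x => sym_grad (w n) x - P x) @[n --> \oo] --> (0 : \bar R)%E.

Definition div_free (s : R * R -> 'M[R]_2) : Prop :=
  forall i psi, test_function setT psi ->
    \int[leb2 R]_x (\sum_j s x i j * partial j psi x) = 0.

Definition solenoidal_part (eps s : R * R -> 'M[R]_2) : Prop :=
  [/\ L2_sym_tensor setT s, div_free s &
      exists P, potential_tensor P /\
        {ae leb2 R, forall x, eps x = P x + s x}].

End Elasticity.

(* Main.v *)
Require Import Defs.
From HB Require Import structures.
From mathcomp Require Import all_boot all_order all_algebra.
From mathcomp Require Import all_classical all_reals all_analysis.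
From mathcomp Require Import measurable_realfun ring lra.
Import Order.TTheory GRing.Theory Num.Theory.
Import numFieldNormedType.Exports.
Local Open Scope classical_set_scope.
Local Open Scope ring_scope.

Set Implicit Arguments.
Unset Strict Implicit.
Unset Printing Implicit Defensive.

(* Put S := stress of the zero extension of eps. Inverting Hooke's law gives
   eps = k S - k m cof S, with k = 1/E, m = nu (plane stress) or
   k = (1 - nu^2)/E, m = nu/(1 - nu) (plane strain), and the claim is that the
   solenoidal part s of eps is k S.
   Let q := s - k S. Testing equilibrium with test functions shows that S, hence
   q, is divergence free on the whole plane. Since eps = P + s with P potential,
   q = - k m cof S - P, and <q, P> = 0 as P is a limit of symmetric gradients. So
   |q|^2 = - k m <q, cof S>, and it remains to see that <S, cof q> = 0 whenever
   q is L^2 and divergence free.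
   Let e = (0, 1). The function psi_i(x) = int_0^1 q_i1(x - t e) dt is in L^2, with
   d_2 psi_i = q_i1 - q_i1(. - e) and d_1 psi_i = - (q_i2 - q_i2(. - e)) weakly, so
   (- psi_2, psi_1) has gradient cof (q - q(. - e)), and the weak traction condition
   yields <S, cof q> = <S, cof q(. - e)>. Iterating, <S, cof q> is
   <S, cof q(. - n e)> for every n, which tends to 0 because S vanishes outside a
   bounded set. *)

(** * Square integrable functions on a measure space *)

Section SquareIntegrable.
Context d (T : measurableType d) (R : realType) (mu : {measure set T -> \bar R}).
Implicit Types (f g : T -> R) (a : R) (D : set T).

Lemma Lfun2P f : f \in Lfun mu 2%:E <->
  measurable_fun setT f /\ mu.-integrable setT (fun x => (f x ^+ 2)%:E).
Proof.
split=> [f2|[mf f2]].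
  split; last exact: Lfun2_integrable_sqr.
  by move: f2; rewrite inE => /andP[+ _]; rewrite inE.
rewrite inE; apply/andP; split; rewrite inE//= /finite_norm unlock.
apply: poweR_lty; move/integrableP : f2 => [_]; apply: le_lt_trans.
rewrite le_eqVlt; apply/orP; left; apply/eqP; apply: eq_integral => x _ /=.
by rewrite normrX powR_mulrn.
Qed.

Lemma Lfun2_measurable f : f \in Lfun mu 2%:E -> measurable_fun setT f.
Proof. by move=> /Lfun2P[]. Qed.

Lemma Lfun2_le f g : measurable_fun setT f -> (forall x, `|f x| <= `|g x|) ->
  g \in Lfun mu 2%:E -> f \in Lfun mu 2%:E.
Proof.
move=> mf fg /Lfun2P[mg g2]; apply/Lfun2P; split => //.
apply: le_integrable g2 => //.
  by apply/measurable_EFinP; exact: measurable_funX.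
by move=> x _; rewrite /= lee_fin !normrX lerXn2r// nnegrE.
Qed.

Lemma Lfun2D f g : f \in Lfun mu 2%:E -> g \in Lfun mu 2%:E ->
  (fun x => f x + g x) \in Lfun mu 2%:E.
Proof. exact: (Lfun_addr_closed mu (lee1n 2)).2. Qed.

Lemma Lfun2Z a f : f \in Lfun mu 2%:E -> (fun x => a * f x) \in Lfun mu 2%:E.
Proof.
move=> f2; have [f0 clo] := Lfun_submod_closed mu (lee1n 2).
by have := clo a _ _ f2 f0; rewrite addr0.
Qed.

Lemma Lfun2N f : f \in Lfun mu 2%:E -> (fun x => - f x) \in Lfun mu 2%:E.
Proof. by move=> /(Lfun2Z (-1)); under eq_fun do rewrite mulN1r. Qed.

Lemma Lfun2B f g : f \in Lfun mu 2%:E -> g \in Lfun mu 2%:E ->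
  (fun x => f x - g x) \in Lfun mu 2%:E.
Proof. by move=> f2 /Lfun2N; exact: Lfun2D. Qed.

Lemma Lfun2_patch D f : measurable D -> f \in Lfun mu 2%:E ->
  f \_ D \in Lfun mu 2%:E.
Proof.
move=> mD f2; apply: (Lfun2_le _ _ f2).
  apply/(measurable_restrictT _ mD).1.
  by apply: measurable_funTS; exact: Lfun2_measurable f2.
by move=> x; rewrite patchE; case: ifP => // _; rewrite normr0.
Qed.

Lemma Lfun2_integrableM f g : f \in Lfun mu 2%:E -> g \in Lfun mu 2%:E ->
  mu.-integrable setT (fun x => (f x * g x)%:E).
Proof. by move=> f2 g2; apply/Lfun1_integrable; exact: Lfun2_mul_Lfun1. Qed.

Lemma Lfun2_measurableM f g : f \in Lfun mu 2%:E -> g \in Lfun mu 2%:E ->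
  measurable_fun setT (fun x => f x * g x).
Proof.
by move=> f2 g2; apply: measurable_funM;
  [exact: Lfun2_measurable f2|exact: Lfun2_measurable g2].
Qed.

Lemma EFin_Rintegral f : mu.-integrable setT (EFin \o f) ->
  (\int[mu]_x (f x)%:E = (\int[mu]_x f x)%:E)%E.
Proof. by move=> if1; rewrite /Rintegral fineK//; exact: integrable_fin_num. Qed.

Lemma Lfun2_integrable_sq f : f \in Lfun mu 2%:E ->
  mu.-integrable setT (fun x => (f x ^+ 2)%:E).
Proof. by move=> /Lfun2P[]. Qed.

Lemma Rintegral_sumr (I : finType) (h : I -> T -> R) :
  (forall i, mu.-integrable setT (EFin \o h i)) ->
  mu.-integrable setT (fun x => (\sum_i h i x)%:E) /\
  \int[mu]_x (\sum_i h i x) = \sum_i \int[mu]_x h i x.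
Proof.
move=> ih; rewrite /index_enum; elim: (Finite.enum I) => [|i s [IH1 IH2]].
  split.
    under eq_fun do rewrite big_nil; exact: integrable0.
  under eq_Rintegral do rewrite big_nil.
  by rewrite big_nil Rintegral_cst// mul0r.
split.
  under eq_fun do rewrite big_cons EFinD.
  by apply: integrableD => //; exact: ih.
under eq_Rintegral do rewrite big_cons.
by rewrite RintegralD// ?IH2 ?big_cons//; exact: ih.
Qed.

(** Pointwise, [(k |f| - |g|)^2 >= 0] gives [2 |f g| <= k f^2 + k^-1 g^2]. The free weight [k] lets
    this stand in for the Cauchy-Schwarz inequality in limit arguments. *)
Lemma Rintegral_amgm f g k : 0 < k ->
  f \in Lfun mu 2%:E -> g \in Lfun mu 2%:E ->
  `|\int[mu]_x (f x * g x)| <=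
    k * \int[mu]_x (f x ^+ 2) + k^-1 * \int[mu]_x (g x ^+ 2).
Proof.
move=> k0 f2 g2.
have ifg := Lfun2_integrableM f2 g2.
have if2 := Lfun2_integrable_sq f2.
have ig2 := Lfun2_integrable_sq g2.
rewrite -RintegralZl// -RintegralZl// -RintegralD//=; last 2 first.
- exact: (integrableZl measurableT _ if2).
- exact: (integrableZl measurableT _ ig2).
apply: (le_trans (le_normr_Rintegral _ ifg)) => //.
apply: le_Rintegral => //.
- exact: (integrable_abse ifg).
- exact: (integrableD measurableT (integrableZl measurableT k if2)
    (integrableZl measurableT k^-1 ig2)).
move=> x _; rewrite normrM.
rewrite -(real_normK (num_real (f x))) -(real_normK (num_real (g x))).
set a := `|f x|; set b := `|g x|.
have /= := sqr_ge0 (k * a - b); have := sqr_ge0 b.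
have a0 : 0 <= a by exact: normr_ge0.
have b0 : 0 <= b by exact: normr_ge0.
move=> h1 h2.
rewrite -(ler_pM2l k0) mulrDr !mulrA mulfV ?gt_eqF// mul1r.
nra.
Qed.

Lemma Rintegral_mul_cvg0 (f_ : nat -> T -> R) g :
  (forall n, f_ n \in Lfun mu 2%:E) -> g \in Lfun mu 2%:E ->
  \int[mu]_x (f_ n x ^+ 2) @[n --> \oo] --> 0 ->
  \int[mu]_x (f_ n x * g x) @[n --> \oo] --> 0.
Proof.
move=> f2 g2 f0; set G := \int[mu]_x (g x ^+ 2).
have G0 : 0 <= G by apply: Rintegral_ge0 => x _; exact: sqr_ge0.
apply/cvgrPdist_le => /= e e0.
(* This weight makes [k^-1 G < e / 2]; taking [G + 1] instead of [G] keeps [k] positive when [g]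
   vanishes. The other half of [e] comes from [n] large enough that the integral of [f_ n ^+ 2] is
   at most [e / (2 k)]. *)
pose k := 2 * (G + 1) / e.
have k0 : 0 < k by rewrite divr_gt0// mulr_gt0// ltr_wpDl.
have e2 : 0 < e / (2 * k) by rewrite divr_gt0// mulr_gt0.
move/cvgrPdist_le : f0 => /(_ _ e2)[N _ fN]; exists N => // n /fN /=.
rewrite !sub0r !normrN => fn.
apply: (le_trans (Rintegral_amgm k0 (f2 n) g2)); rewrite -/G.
rewrite (splitr e) lerD//.
  apply: (le_trans (ler_wpM2l (ltW k0) (le_trans (ler_norm _) fn))).
  rewrite le_eqVlt; apply/orP; left; apply/eqP; field.
  by rewrite !gt_eqF// ltr_wpDl.
rewrite mulrC ler_pdivrMr// /k mulrA.
rewrite le_eqVlt; apply/orP; right.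
rewrite [ltRHS](_ : _ = G + 1) ?ltrDl//; field.
by rewrite gt_eqF.
Qed.

Lemma Lfun2_eq0 f : f \in Lfun mu 2%:E -> \int[mu]_x (f x ^+ 2) = 0 ->
  {ae mu, forall x, f x = 0}.
Proof.
move=> f2 f0; have if2 := Lfun2_integrable_sq f2.
have : (\int[mu]_x `|(f x ^+ 2)%:E| = 0)%E.
  under eq_integral do rewrite gee0_abs ?lee_fin ?sqr_ge0//.
  by rewrite -(fineK (integrable_fin_num measurableT if2)) [fine _]f0.
move/(ae_eq_integral_abs mu measurableT (measurable_int mu if2)).
by apply: filterS => x /= /(_ I) [] /eqP; rewrite sqrf_eq0 => /eqP.
Qed.

End SquareIntegrable.

(** * Translation invariance of Lebesgue measure on the plane *)

Section Translation.
Variable R : realType.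
Local Notation leb := (@lebesgue_measure R).
Local Notation plane := (measurableTypeR R * measurableTypeR R)%type.
Implicit Types (v z : R * R) (f h : R * R -> R).

(** The pushforward under the shift agrees with Lebesgue measure on half-open intervals, and these
    determine the measure. *)
Lemma lebesgue_measure_translation (a : R) (A : set (measurableTypeR R)) :
  measurable A -> leb ((fun x => x + a) @^-1` A) = leb A.
Proof.
have ma : measurable_fun (T := measurableTypeR R) (U := measurableTypeR R)
  setT (fun x : R => x + a) by apply: measurable_funD.
move=> mA.
pose shift (x : measurableTypeR R) : measurableTypeR R := x + a.
rewrite -[LHS]/(pushforward leb shift A).
apply/esym/lebesgue_measure_unique => //= _ [[b c]] _ <-; rewrite /pushforward /=.
rewrite [X in _ = leb X](_ : _ = `]b - a, c - a]%classic); last first.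
  by apply/seteqP; split => x /=; rewrite !in_itv /= ltrBlDr lerBrDr.
by rewrite !lebesgue_measure_itv/= !lte_fin ltrD2r -!EFinD opprB addrA subrK.
Qed.

Lemma measurable_translation v :
  measurable_fun (T := plane) (U := plane) setT (fun z => z + v).
Proof.
apply/measurable_fun_pairP; split.
  by apply: (@measurable_funD _ _ _ _ fst (cst v.1)).
by apply: (@measurable_funD _ _ _ _ snd (cst v.2)).
Qed.

(** A product measure is determined by its values on measurable rectangles, where the
    one-dimensional invariance applies to each side. *)
Lemma leb2_translation v (A : set plane) : measurable A ->
  leb2 R ((fun z => z + v) @^-1` A) = leb2 R A.
Proof.
move=> mA.
pose shift (z : plane) : plane := z + v.
rewrite /leb2 [RHS](@product_measure_unique _ _ _ _ _ _ _
  (pushforward (leb2 R) shift)) //.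
  exact: measurable_translation.
move=> mv B C mB mC; rewrite /= /pushforward.
rewrite (_ : _ @^-1` _ =
    ((fun x => x + v.1) @^-1` B) `*` ((fun x => x + v.2) @^-1` C)); last first.
  by apply/seteqP; split.
have mt (a : R) (D : set (measurableTypeR R)) : measurable D ->
    measurable ((fun x : measurableTypeR R => (x + a : measurableTypeR R)) @^-1` D).
  move=> mD; rewrite -[X in measurable X]setTI.
  exact: (measurable_funD (@measurable_id _ _ _) (measurable_cst _)).
rewrite product_measure1E; [|exact: mt..].
by congr (_ * _)%E; exact: lebesgue_measure_translation.
Qed.

(** Change of variables along the pushforward, applied to the positive and negative parts
    separately. *)
Lemma Rintegral_translation v f : measurable_fun (T := plane) setT f ->
  \int[leb2 R]_z f (z + v) = \int[leb2 R]_z f z.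
Proof.
move=> mf; have mv := measurable_translation v.
have E (g : plane -> \bar R) : measurable_fun setT g -> (forall z, 0 <= g z)%E ->
    (\int[leb2 R]_z g (z + v)%R = \int[leb2 R]_z g z)%E.
  move=> mg g0.
  rewrite -[LHS](ge0_integral_pushforward mv (leb2 R) measurableT mg) => [|z _]; last first.
    exact: g0.
  by apply: eq_measure_integral => A mA _ /=; exact: leb2_translation.
rewrite /Rintegral [in LHS]integralE [in RHS]integralE.
have mfe : measurable_fun setT (EFin \o f : plane -> \bar R) by apply/measurable_EFinP.
rewrite -(E _ (measurable_funepos mfe) (fun=> funepos_ge0 _ _)).
rewrite -(E _ (measurable_funeneg mfe) (fun=> funeneg_ge0 _ _)).
by congr (fine (_ - _)%E); apply: eq_integral => z _; rewrite ?funeposE ?funenegE.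
Qed.

Lemma integrable_translation v f :
  (leb2 R).-integrable setT (EFin \o f) ->
  (leb2 R).-integrable setT (fun z => (f (z + v))%:E).
Proof.
move=> /integrableP[mf f1]; have mv := measurable_translation v.
apply/integrableP; split; first exact: (measurableT_comp mf mv).
have ma : measurable_fun setT (fun z : plane => `|(f z)%:E|%E).
  exact: measurableT_comp mf.
have := ge0_integral_pushforward mv (leb2 R) measurableT ma (fun _ _ => abse_ge0 _).
rewrite preimage_setT => <-.
rewrite (@eq_measure_integral _ _ _ _ (leb2 R))// => A mA _ /=; exact: leb2_translation.
Qed.

Lemma Lfun2_translation v f : f \in Lfun (leb2 R) 2%:E ->
  (fun z => f (z + v)) \in Lfun (leb2 R) 2%:E.
Proof.
move=> /Lfun2P[mf f2]; apply/Lfun2P; split.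
  exact: (measurableT_comp mf (measurable_translation v)).
exact: (integrable_translation v f2).
Qed.

End Translation.

(** * Measurability and square integrability of continuous functions on the plane *)

Section PlaneTopology.
Variable R : realType.
Local Notation plane := (measurableTypeR R * measurableTypeR R)%type.
Implicit Types (v z : R * R) (f h : R * R -> R) (K : set (R * R)).

(** An open set is the countable union of the open rectangles with rational corners that it
    contains; this links the product topology to the product sigma-algebra. *)
Lemma open_measurable_plane (A : set (R * R)) : open A -> measurable (A : set plane).
Proof.
move=> oA.
pose B (p q r s : rat) : set plane :=
  `]ratr p, ratr q[%classic `*` `]ratr r, ratr s[%classic.
(* [C p q r s] is the whole rectangle when it lies in [A] and empty otherwise, so the union can run
   over all rationals. *)
pose C p q r s : set plane := [set z | B p q r s `<=` A /\ B p q r s z].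
have -> : A = \bigcup_p \bigcup_q \bigcup_r \bigcup_s C p q r s.
  apply/seteqP; split => [z Az|z [p _ [q _ [r _ [s _ [sA]]]]]]; last exact: sA.
  have /nbhs_ballP[e /= e0 eA] : nbhs z A by exact: open_nbhs_nbhs.
  have ratl (x : R) : exists q : rat, (x - e < ratr q) && (ratr q < x).
    by have [|q] := @rat_in_itvoo R (x - e) x; [rewrite ltrBlDr ltrDl|rewrite in_itv; exists q].
  have ratg (x : R) : exists q : rat, (x < ratr q) && (ratr q < x + e).
    by have [|q] := @rat_in_itvoo R x (x + e); [rewrite ltrDl|rewrite in_itv; exists q].
  have [p /andP[p1 p2]] := ratl z.1; have [q /andP[q1 q2]] := ratg z.1.
  have [r /andP[r1 r2]] := ratl z.2; have [s /andP[s1 s2]] := ratg z.2.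
  exists p => //; exists q => //; exists r => //; exists s => //; split; last first.
    by split; rewrite /= in_itv/= ?p2 ?r2.
  move=> y [/=]; rewrite !in_itv/= => /andP[y1 y2] /andP[y3 y4]; apply: eA.
  by split; rewrite /= /ball/= ltr_distl; apply/andP; split; lra.
apply: bigcupT_measurable_rat => p; apply: bigcupT_measurable_rat => q.
apply: bigcupT_measurable_rat => r; apply: bigcupT_measurable_rat => s.
have [sA|nsA] := pselect (B p q r s `<=` A).
  rewrite (_ : C p q r s = B p q r s); first exact: measurableX.
  by apply/seteqP; split => z => [[]|].
rewrite (_ : C p q r s = set0); first exact: measurable0.
by apply/seteqP; split => z => [[]|].
Qed.

Lemma continuous_measurable_plane f : continuous f ->
  measurable_fun (T := plane) setT f.
Proof.
move=> /continuousP cf; apply: (measurability _ (RGenOpens.measurableE R)).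
move=> _ [_ [a [b ->] <-]]; rewrite setTI.
by apply: open_measurable_plane; exact/cf/interval_open.
Qed.

Lemma continuous_compact_support_bounded f K : continuous f -> compact K ->
  (forall z, ~ K z -> f z = 0) ->
  exists M c : R, forall z, `|f z| <= c * \1_(`[- M, M]%classic `*` `[- M, M]%classic) z.
Proof.
move=> cf cK f0.
have [M0 [_ KM]] := compact_bounded cK.
have /compact_bounded[c0 [_ fc]] := @continuous_compact _ _ f K (continuous_subspaceT cf) cK.
(* Boundedness provides every bound strictly above [c0], hence the [+ 1]; the maximum with 0 keeps
   the right-hand side nonnegative off [K]. *)
pose c := Num.max (c0 + 1) 0.
exists (M0 + 1), c => z; have [Kz|nKz] := pselect (K z).
  have zM : `|z| <= M0 + 1 by apply: KM Kz; rewrite ltrDl.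
  rewrite indicE mem_set ?mulr1.
    rewrite le_max; apply/orP; left; apply: fc; first by rewrite ltrDl.
    by exists z.
  move: zM; rewrite prod_normE ge_max => /andP[z1 z2].
  by split => /=; rewrite in_itv/= -ler_norml.
by rewrite f0// normr0 mulr_ge0// le_max lexx orbT.
Qed.

Lemma Lfun2_continuous_compact_support f K : continuous f -> compact K ->
  (forall z, ~ K z -> f z = 0) -> f \in Lfun (leb2 R) 2%:E.
Proof.
move=> cf cK f0; have [M [c fc]] := continuous_compact_support_bounded cf cK f0.
have mB : measurable (`[- M, M]%classic `*` `[- M, M]%classic : set plane).
  exact: measurableX.
apply: (@Lfun2_le _ plane R (leb2 R) f
  (fun z => c * \1_(`[- M, M]%classic `*` `[- M, M]%classic) z)).
- exact: continuous_measurable_plane.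
- by move=> z; rewrite (le_trans (fc z))// ler_norm.
apply: Lfun2Z; apply/Lfun2P; split; first exact: measurable_indic.
rewrite (_ : (fun _ => _) = EFin \o \1_(`[- M, M]%classic `*` `[- M, M]%classic : set plane)).
  apply/integrableP; split; first by apply/measurable_EFinP; exact: measurable_indic.
  under eq_integral do rewrite gee0_abs ?lee_fin//=.
  rewrite integral_indic// setIT// /leb2/= product_measure1E//.
  have ltM : (@lebesgue_measure R `[(- M)%R, M]%classic < +oo)%E.
    by rewrite lebesgue_measure_itv/=; case: ifP => //; rewrite -EFinB ltry.
  by rewrite lte_mul_pinfty// ge0_fin_numE.
by apply/funext => z; rewrite /= indicE; case: (_ \in _); rewrite ?expr1n ?expr0n.
Qed.

End PlaneTopology.

(** * Test functions: translation, support, integration along a segment *)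

Section TestFunctions.
Variable R : realType.
Local Notation plane := (measurableTypeR R * measurableTypeR R)%type.
Implicit Types (v z : R * R) (f g psi : R * R -> R) (K Omega : set (R * R)).

Lemma partial_translation i v f z :
  partial i (fun y => f (y + v)) z = partial i f (z + v).
Proof.
by rewrite /partial /derive; under eq_fun do rewrite /= -addrA.
Qed.

Lemma derivable_translation w v f z :
  derivable f (z + v) w -> derivable (fun y => f (y + v)) z w.
Proof.
rewrite /derivable => df; rewrite [X in cvg (X @ _)](_ : _ =
  fun h : R => h^-1 *: (f (h *: w + (z + v)) - f (z + v)))//.
by apply/funext => h /=; rewrite addrA.
Qed.

Lemma class_C_translation n v f : class_C n f -> class_C n (fun z => f (z + v)).
Proof.
have cv : continuous (fun z : R * R => z + v).
  by move=> z; apply: cvgD; [exact: cvg_id|exact: cvg_cst].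
elim: n f => [|n IH] f /=.
  by move=> cf z; exact: (continuous_comp (cv z) (cf _)).
move=> [cf df]; split; first by move=> z; exact: (continuous_comp (cv z) (cf _)).
move=> i; have [dfi Cfi] := df i; split => [z|].
  exact/derivable_translation.
by rewrite (_ : partial i _ = fun z => partial i f (z + v)); [exact: IH|
  apply/funext => z; exact: partial_translation].
Qed.

(** [K] is the closed support: off it [psi] vanishes on a whole neighbourhood, so its partial
    derivatives vanish there too. *)
Lemma test_function_support Omega psi : test_function Omega psi ->
  exists K, [/\ compact K, K `<=` Omega,
    forall z, ~ K z -> psi z = 0 & forall i z, ~ K z -> partial i psi z = 0].
Proof.
move=> [_ cK KO]; exists (closure [set x | psi x != 0]); split => //.
  move=> z nz; apply/eqP/negPn/negP => z0; apply: nz.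
  exact: subset_closure.
move=> i z nz; have nz0 : \near z, psi z = cst 0 z.
  have : nbhs z (~` closure [set x | psi x != 0]).
    by apply: open_nbhs_nbhs; split => //; exact/closed_openC/closed_closure.
  apply: filterS => y ny; apply/eqP/negPn/negP => y0; apply: ny.
  exact: subset_closure.
rewrite /partial (near_eq_derive _ nz0) ?derive_cst//.
Qed.

Lemma test_functionP psi K : smooth psi -> compact K ->
  (forall z, ~ K z -> psi z = 0) -> test_function setT psi.
Proof.
move=> spsi cK K0; split => //.
apply: subclosed_compact (cK) _; first exact: closed_closure.
rewrite (closure_id K).1; last exact: compact_closed.
apply: closure_subset => z /= /eqP z0; apply: contrapT => nK.
by apply: z0; exact: K0.
Qed.

Lemma test_function_setT Omega psi : test_function Omega psi -> test_function setT psi.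
Proof. by move=> [? ? ?]; split. Qed.

Lemma test_function_translation v psi :
  test_function setT psi -> test_function setT (fun z => psi (z + v)).
Proof.
move=> tpsi; have [K [cK _ K0 _]] := test_function_support tpsi.
apply: (@test_functionP _ ((fun z => z - v) @` K)).
- by case: tpsi => + _ _ n => /(_ n); exact: class_C_translation.
- apply: continuous_compact => //; apply: continuous_subspaceT.
  by move=> z; apply: cvgB; [exact: cvg_id|exact: cvg_cst].
- move=> z nz; apply: K0; apply: contra_not nz => Kz.
  by exists (z + v) => //; rewrite addrK.
Qed.

Lemma test_function_continuous Omega psi : test_function Omega psi -> continuous psi.
Proof. by move=> [/(_ 0%N)]. Qed.

Lemma test_function_derivable Omega psi i z :
  test_function Omega psi -> derivable psi z (basis2 R i).
Proof. by move=> [/(_ 1%N)[_ /(_ i)[+ _]] _ _]; exact. Qed.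

Lemma test_function_continuous_partial Omega psi i :
  test_function Omega psi -> continuous (partial i psi).
Proof. by move=> [/(_ 1%N)[_ /(_ i)[]]]. Qed.

Lemma Lfun2_test_function Omega psi :
  test_function Omega psi -> psi \in Lfun (leb2 R) 2%:E.
Proof.
move=> tpsi; have [K [cK _ K0 _]] := test_function_support tpsi.
exact: Lfun2_continuous_compact_support (test_function_continuous tpsi) cK K0.
Qed.

Lemma Lfun2_partial_test_function Omega psi i :
  test_function Omega psi -> partial i psi \in Lfun (leb2 R) 2%:E.
Proof.
move=> tpsi; have [K [cK _ _ K0]] := test_function_support tpsi.
exact: Lfun2_continuous_compact_support (test_function_continuous_partial tpsi) cK (K0 i).
Qed.

(** The fundamental theorem of calculus for the restriction [g] of [f] to the unit segment issuing
    from [z] in direction [i]. *)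
Lemma integral_partial_FTC i f z : (forall x, derivable f x (basis2 R i)) ->
  continuous (partial i f) ->
  (\int[@lebesgue_measure R]_(t in `[0%R, 1%R]) (partial i f (z + t *: basis2 R i))%:E
    = (f (z + basis2 R i) - f z)%:E)%E.
Proof.
move=> df cf; set e := basis2 R i.
pose g (t : R) := f (z + t *: e).
have ce : continuous (fun t : R => z + t *: e).
  by move=> t; apply: cvgD; [exact: cvg_cst|apply: cvgZr_tmp; exact: cvg_id].
(* The difference quotients of [g] at [t] are literally those of [f] at [z + t e] in direction [e],
   so derivability and the value of the derivative transfer together. *)
have E (t : R) : (fun h : R => h^-1 *: (g (h *: 1 + t) - g t)) =
   (fun h => h^-1 *: (f (h *: e + (z + t *: e)) - f (z + t *: e))).
  apply/funext => h; rewrite /g; congr (_ *: (f _ - _)).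
  by rewrite /GRing.scale/= mulr1 -[LHS]/(z + (h + t) *: e) scalerDl addrCA.
have dg (t : R) : derivable g t 1.
  by rewrite /derivable [X in cvg (X @ _)]E; exact: df.
have gE (t : R) : derive1 g t = partial i f (z + t *: e).
  by rewrite derive1E /partial /derive [X in lim (X @ _)]E.
have cg : continuous g.
  by move=> t; apply: differentiable_continuous; exact/derivable1_diffP.
have cdg : {within `[0, 1], continuous (fun t : R => partial i f (z + t *: e))}.
  by apply: continuous_subspaceT => t; exact: (continuous_comp (ce t) (cf _)).
have dLR : derivable_oo_LRcontinuous g 0 1.
  split; [by move=> t _; exact: dg|exact: cvg_at_right_filter (cg 0)|].
  exact: cvg_at_left_filter (cg 1).
rewrite (continuous_FTC2 ltr01 cdg dLR (fun t _ => gE t)).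
by rewrite -EFinB /g scale1r scale0r addr0.
Qed.

End TestFunctions.

(** * Sigma-finiteness of Lebesgue measure on the plane *)

Section ProductSigmaFinite.
Variable R : realType.
Local Notation leb := (@lebesgue_measure R).

(* Convertible to [leb2 R], but with the sigma-finite structure that the Fubini
   theorems ask for. *)
Definition leb2_sigma_finite := (leb \x leb)%E.

HB.instance Definition _ := Measure.on leb2_sigma_finite.

(** Squares of an exhausting nondecreasing sequence exhaust the plane: monotonicity puts both
    coordinates of a point in the set of the larger index. *)
Lemma sigma_finite_leb2 : sigma_finite setT leb2_sigma_finite.
Proof.
have /sigma_finiteP[F [TF ndF Foo]] := sigma_finiteT leb.
exists (fun n => F n `*` F n).
  rewrite -setXTT TF predeqE => -[x y]; split.
    move=> [/= [n _ Fnx] [k _ Fky]]; exists (maxn n k) => //; split.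
    - by move: x Fnx; exact/subsetPset/ndF/leq_maxl.
    - by move: y Fky; exact/subsetPset/ndF/leq_maxr.
  by move=> [n _ []/= ? ?]; split; exists n.
move=> k; have [mF Fk] := Foo k; split; first exact: measurableX.
by rewrite /leb2_sigma_finite product_measure1E// lte_mul_pinfty// ge0_fin_numE.
Qed.

HB.instance Definition _ :=
  Measure_isSigmaFinite.Build _ _ _ leb2_sigma_finite sigma_finite_leb2.

End ProductSigmaFinite.

(** * Averages of translates along a line *)

Section Average.
Variables (R : realType) (P : probability (measurableTypeR R) R).
Local Notation plane := (measurableTypeR R * measurableTypeR R)%type.
Local Notation mu := (@leb2_sigma_finite R).
Implicit Types (e z : R * R) (f g h : R * R -> R).

(** With [P] uniform on [0, 1] and [e = (0, 1)], this applied to the entries [q_i1] yields the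
    functions [psi_i] of the overview. The estimates only use that [P] has mass 1. *)
Definition average e f z : R := \int[P]_t f (z - t *: e).

Lemma measurable_line e : measurable_fun
  (T := (plane * measurableTypeR R)%type) (U := plane) setT (fun p => p.1 - p.2 *: e).
Proof.
apply/measurable_fun_pairP; split.
  apply: (@measurable_funB _ _ _ _ (fst \o fst)
    (fun p : plane * measurableTypeR R => p.2 * e.1)).
    exact: measurableT_comp.
  exact: measurable_funM.
apply: (@measurable_funB _ _ _ _ (snd \o fst)
  (fun p : plane * measurableTypeR R => p.2 * e.2)).
  exact: measurableT_comp.
exact: measurable_funM.
Qed.

Lemma measurable_line_section e z :
  measurable_fun (T := measurableTypeR R) (U := plane) setT (fun t => z - t *: e).
Proof. exact: (measurableT_comp (measurable_line e) (pair1_measurable z)). Qed.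

(** Tonelli with the plane integrated first: by translation invariance the inner integral of [|f|]
    is the same for every [t], and [P] has mass 1. *)
Lemma integrable_line e f : (leb2 R).-integrable setT (EFin \o f) ->
  (mu \x P)%E.-integrable setT (fun p => (f (p.1 - p.2 *: e))%:E).
Proof.
move=> if1; have mf := measurable_int _ if1.
have mF : measurable_fun setT
    (fun p : plane * measurableTypeR R => (f (p.1 - p.2 *: e))%:E).
  exact: (measurableT_comp mf (measurable_line e)).
apply/(integrable21ltyP mu P mF).
have E (t : R) : (\int[mu]_x `|(f (x - t *: e))%:E| = \int[mu]_x `|(f x)%:E|)%E.
  have ift := integrable_translation (- (t *: e)) if1.
  rewrite (EFin_Rintegral (integrable_abse ift)) (EFin_Rintegral (integrable_abse if1)).
  congr EFin; apply: (@Rintegral_translation R (- (t *: e)) (fun z => `|f z|)).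
  by apply: measurableT_comp => //; exact/measurable_EFinP.
under eq_integral do rewrite E.
set I := (\int[mu]_x _)%E; rewrite (integral_cst P measurableT I).
rewrite [X in (_ * X)%E](probability_setT P) mule1 /I.
by move/integrableP : if1 => [].
Qed.

Lemma integrable_line_mul e f g :
  f \in Lfun (leb2 R) 2%:E -> g \in Lfun (leb2 R) 2%:E ->
  (mu \x P)%E.-integrable setT (fun p => (f (p.1 - p.2 *: e) * g p.1)%:E).
Proof.
move=> f2 g2.
have i1 := integrable_line e (Lfun2_integrable_sq f2).
(* Direction 0 makes the line constant, so this is the integrability of [g(x)^2] in the pair
   [(x, t)]. The product is then dominated by the sum of the two squares. *)
have i2 := integrable_line 0 (Lfun2_integrable_sq g2).
apply: le_integrable (integrableD measurableT i1 i2) => //.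
  apply/measurable_EFinP/measurable_funM.
    exact: (measurableT_comp (Lfun2_measurable f2) (measurable_line e)).
  exact: (measurableT_comp (Lfun2_measurable g2)).
move=> p _; rewrite /= lee_fin scaler0 subr0 normrM.
rewrite [leRHS]ger0_norm ?addr_ge0 ?sqr_ge0//.
rewrite -(real_normK (num_real (f _))) -(real_normK (num_real (g _))).
set a := `|f _|; set b := `|g _|.
by have := sqr_ge0 (a - b); have := sqr_ge0 (a + b); nra.
Qed.

Lemma measurable_average e f : measurable_fun (T := plane) setT f ->
  measurable_fun (T := plane) setT (average e f).
Proof.
move=> mf; rewrite /average /Rintegral.
have mF : measurable_fun setT
    (fun p : plane * measurableTypeR R => (f (p.1 - p.2 *: e))%:E).
  by apply/measurable_EFinP; exact: (measurableT_comp mf (measurable_line e)).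
apply: measurableT_comp => //.
under eq_fun do rewrite integralE.
apply: emeasurable_funB.
  have := measurable_fun_fubini_tonelli_F (m2 := P) _
    (measurable_funepos mF) (fun=> funepos_ge0 _ _).
  congr (measurable_fun _ _); apply/funext => z; apply: eq_integral => t _.
  by rewrite !funeposE.
have := measurable_fun_fubini_tonelli_F (m2 := P) _
  (measurable_funeneg mF) (fun=> funeneg_ge0 _ _).
congr (measurable_fun _ _); apply/funext => z; apply: eq_integral => t _.
by rewrite !funenegE.
Qed.

(** [|h| <= h^2 + 1], and constants are integrable for a probability. *)
Lemma probability_Lfun2_integrable (h : R -> R) :
  measurable_fun (T := measurableTypeR R) setT h ->
  P.-integrable setT (fun t => (h t ^+ 2)%:E) -> P.-integrable setT (EFin \o h).
Proof.
move=> mh h2; have c1 := finite_measure_integrable_cst P 1 measurableT.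
apply: le_integrable (integrableD measurableT h2 c1) => //.
  exact/measurable_EFinP.
move=> t _; rewrite /= lee_fin [leRHS]ger0_norm ?addr_ge0 ?sqr_ge0//.
rewrite -(real_normK (num_real (h t))); set a := `|h t|.
by have := sqr_ge0 (a - 1); have := sqr_ge0 (a + 1); nra.
Qed.

(** Jensen's inequality for the square, obtained by expanding the nonnegative variance of [h]. *)
Lemma sqr_Rintegral_le (h : R -> R) :
  measurable_fun (T := measurableTypeR R) setT h ->
  P.-integrable setT (fun t => (h t ^+ 2)%:E) ->
  (\int[P]_t h t) ^+ 2 <= \int[P]_t (h t ^+ 2).
Proof.
move=> mh h2; have h1 := probability_Lfun2_integrable mh h2.
set m := \int[P]_t h t.
have c1 := finite_measure_integrable_cst P (m ^+ 2) measurableT.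
have : 0 <= \int[P]_t ((h t - m) ^+ 2) by apply: Rintegral_ge0 => t _; exact: sqr_ge0.
have i2 := integrableZl measurableT (- (2 * m)) h1.
have -> : \int[P]_t ((h t - m) ^+ 2) =
    \int[P]_t (h t ^+ 2 + (- (2 * m)) * h t + m ^+ 2).
  by apply: eq_Rintegral => t _; ring.
have Icst : \int[P]_t (m ^+ 2) = m ^+ 2.
  rewrite (Rintegral_cst P measurableT (m ^+ 2)).
  by rewrite (_ : fine _ = 1) ?mulr1// -[RHS]/(fine 1%E) -(probability_setT P).
rewrite (RintegralD measurableT (integrableD measurableT h2 i2) c1) Icst.
rewrite (RintegralD measurableT h2 i2) (RintegralZl _ measurableT h1) -/m.
nra.
Qed.

(** By Jensen the square of the average is at most the average of the square, which is integrable by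
    Fubini. *)
Lemma Lfun2_average e f : f \in Lfun (leb2 R) 2%:E ->
  average e f \in Lfun (leb2 R) 2%:E.
Proof.
move=> f2; have mf := Lfun2_measurable f2.
have mav := measurable_average e mf.
apply/Lfun2P; split => //.
have i2 := integrable_fubini_F (integrable_line e (Lfun2_integrable_sq f2)).
apply: le_integrable i2 => //.
  by apply/measurable_EFinP; exact: measurable_funX.
move=> z _.
rewrite [leRHS]gee0_abs; last by apply: integral_ge0 => t _; rewrite lee_fin sqr_ge0.
rewrite gee0_abs ?lee_fin ?sqr_ge0// /fubini_F/=.
(* Jensen needs a square integrable section; where the average of the square is infinite the bound
   is trivial. *)
have [oo|fin] := eqVneq (\int[P]_t (f (z - t *: e) ^+ 2)%:E)%E +oo%E.
  by rewrite oo leey.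
have mh : measurable_fun (T := measurableTypeR R) setT (fun t : R => f (z - t *: e)).
  exact: (measurableT_comp mf (measurable_line_section e z)).
have h2 : P.-integrable setT (fun t => (f (z - t *: e) ^+ 2)%:E).
  apply/integrableP; split; first by apply/measurable_EFinP; exact: measurable_funX.
  by under eq_integral do rewrite gee0_abs ?lee_fin ?sqr_ge0//; rewrite ltey.
rewrite -(fineK (integrable_fin_num measurableT h2)) lee_fin.
exact: sqr_Rintegral_le.
Qed.

(** Fubini, followed by the substitution of [z + t e] for [z] in the inner integral. *)
Lemma Rintegral_average_mul e f g :
  f \in Lfun (leb2 R) 2%:E -> g \in Lfun (leb2 R) 2%:E ->
  \int[leb2 R]_z (average e f z * g z) =
  \int[P]_t \int[leb2 R]_z (f z * g (z + t *: e)).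
Proof.
move=> f2 g2; have iF := integrable_line_mul e f2 g2.
have mf := Lfun2_measurable f2; have mg := Lfun2_measurable g2.
transitivity (fine (\int[mu]_z \int[P]_t (f (z - t *: e) * g z)%:E)%E).
  congr fine; apply: ae_eq_integral => //.
  - apply/measurable_EFinP/measurable_funM => //; exact: measurable_average.
  - exact: measurable_int _ (integrable_fubini_F iF).
  (* For almost every [z] the section of [f] along the line is square integrable, hence integrable,
     which allows the factor [g z] to enter the integral over [t]. *)
  have := integrable_ae measurableT
    (integrable_fubini_F (integrable_line e (Lfun2_integrable_sq f2))).
  apply: filterS => z /(_ I) fin _; rewrite /fubini_F/= in fin.
  have mh : measurable_fun (T := measurableTypeR R) setT (fun t : R => f (z - t *: e)).
    exact: (measurableT_comp mf (measurable_line_section e z)).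
  have h2 : P.-integrable setT (fun t => (f (z - t *: e) ^+ 2)%:E).
    apply/integrableP; split; first by apply/measurable_EFinP; exact: measurable_funX.
    under eq_integral do rewrite gee0_abs ?lee_fin ?sqr_ge0//.
    by rewrite -ge0_fin_numE//; apply: integral_ge0 => t _; rewrite lee_fin sqr_ge0.
  have h1 := probability_Lfun2_integrable mh h2.
  under [RHS]eq_integral do rewrite EFinM.
  by rewrite integralZr// [LHS]EFinM /average /Rintegral fineK// integrable_fin_num.
rewrite (Fubini iF); congr fine; apply: eq_integral => t _.
have ft2 := Lfun2_translation (- (t *: e)) f2.
rewrite -[LHS](esym (EFin_Rintegral (Lfun2_integrableM ft2 g2))); congr EFin.
rewrite -[LHS]/(\int[leb2 R]_z (f (z - t *: e) * g z)).
rewrite -(@Rintegral_translation R (t *: e)).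
  by apply: eq_Rintegral => z _; rewrite addrK.
exact: Lfun2_measurableM ft2 g2.
Qed.

End Average.

(** The modulus of the inner integral is at most the inner integral of [|f|], whose integral over
    [T2] is finite by Tonelli. *)
Lemma integrable_fubini_G d1 d2 (T1 : measurableType d1) (T2 : measurableType d2)
    (R : realType) (m1 : {sigma_finite_measure set T1 -> \bar R})
    (m2 : {sigma_finite_measure set T2 -> \bar R}) (f : T1 * T2 -> \bar R) :
  (m1 \x m2)%E.-integrable setT f -> m2.-integrable setT (fubini_G m1 f).
Proof.
move=> iF; have mf := measurable_int _ iF; have mG := measurable_fubini_G iF.
have maf : measurable_fun setT (fun p => `|f p|%E) by exact: measurableT_comp.
apply/integrableP; split => //.
apply: le_lt_trans ((integrable21ltyP _ _ mf).1 iF).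
apply: ge0_le_integral => //.
- exact: measurableT_comp.
- exact: (measurable_fun_fubini_tonelli_G (m1 := m1) _ maf (fun=> abse_ge0 _)).
move=> t _; apply: le_abse_integral => //.
exact: (measurableT_comp mf (pair2_measurable t)).
Qed.

(** * Stream functions of differences of translates, and decay of correlations *)

Section StreamFunction.
Variable R : realType.
Local Notation plane := (measurableTypeR R * measurableTypeR R)%type.
Local Notation U := (uniform_prob (@ltr01 R)).
Implicit Types (e z : R * R) (f g chi : R * R -> R) (Omega : set (R * R)).

Lemma integral_uniform01 (g : R -> R) : measurable_fun (T := measurableTypeR R) setT g ->
  (\int[U]_t (g t)%:E = \int[@lebesgue_measure R]_(t in `[0%R, 1%R]) (g t)%:E)%E.
Proof.
move=> mg; have mge : measurable_fun setT (EFin \o g : measurableTypeR R -> \bar R).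
  exact/measurable_EFinP.
rewrite [in LHS]integralE [in RHS]integralE.
rewrite integral_uniform; [|exact: measurable_funepos|by []].
rewrite integral_uniform; [|exact: measurable_funeneg|by []].
by rewrite subr0 invr1 !mul1e.
Qed.

(** The direction carries a minus sign because this average arises as the adjoint of the one in
    direction [basis2 R j]. *)
Lemma integral_uniform_partial j f z : (forall x, derivable f x (basis2 R j)) ->
  continuous (partial j f) ->
  (\int[U]_t (partial j f (z - t *: - basis2 R j))%:E = (f (z + basis2 R j) - f z)%:E)%E.
Proof.
move=> df cf; rewrite integral_uniform01; last first.
  exact: (measurableT_comp (continuous_measurable_plane cf)
    (measurable_line_section _ z)).
by under eq_integral do rewrite scalerN opprK; exact: integral_partial_FTC.
Qed.

(** The adjoint of a translation is the opposite translation, and averaging over [t] preserves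
    this. *)
Lemma average_adjoint (P : probability (measurableTypeR R) R) e f g :
  f \in Lfun (leb2 R) 2%:E -> g \in Lfun (leb2 R) 2%:E ->
  \int[leb2 R]_z (average P e f z * g z) = \int[leb2 R]_z (f z * average P (- e) g z).
Proof.
move=> f2 g2; rewrite (Rintegral_average_mul P e f2 g2).
under [RHS]eq_Rintegral do rewrite mulrC.
rewrite (Rintegral_average_mul P (- e) g2 f2); apply: eq_Rintegral => t _.
have ft2 := Lfun2_translation (t *: - e) f2.
rewrite -[RHS](@Rintegral_translation R (t *: e)); last first.
  exact: Lfun2_measurableM g2 ft2.
by apply: eq_Rintegral => z _; rewrite scalerN addrK mulrC.
Qed.

Lemma integrable_correlation (P : probability (measurableTypeR R) R) e f g :
  f \in Lfun (leb2 R) 2%:E -> g \in Lfun (leb2 R) 2%:E ->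
  P.-integrable setT (fun t => (\int[leb2 R]_z (f z * g (z + t *: e)))%:E).
Proof.
move=> f2 g2; have := integrable_fubini_G (integrable_line_mul P e f2 g2).
congr (_.-integrable _ _); apply/funext => t.
have ft2 := Lfun2_translation (- (t *: e)) f2.
rewrite /fubini_G -[LHS](esym (EFin_Rintegral (Lfun2_integrableM ft2 g2))); congr EFin.
rewrite -[LHS]/(\int[leb2 R]_z (f (z - t *: e) * g z)).
rewrite -(@Rintegral_translation R (t *: e)).
  by apply: eq_Rintegral => z _; rewrite addrK.
exact: Lfun2_measurableM ft2 g2.
Qed.

(** Weakly, the [j]-th derivative of the average of [f] is [f - f(. - e)]: the average is moved to
    the test function, where the fundamental theorem of calculus turns it into [chi(. + e) - chi],
    and a translation brings the shift back to [f]. *)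
Lemma Rintegral_average_partial j f chi : f \in Lfun (leb2 R) 2%:E ->
  test_function setT chi ->
  \int[leb2 R]_z (average U (basis2 R j) f z * partial j chi z) =
  - \int[leb2 R]_z ((f z - f (z - basis2 R j)) * chi z).
Proof.
move=> f2 tchi; set e := basis2 R j.
have chi2 := Lfun2_test_function tchi.
have dchi2 := Lfun2_partial_test_function j tchi.
have te := test_function_translation e tchi.
have E z : average U (- e) (partial j chi) z = chi (z + e) - chi z.
  rewrite /average /Rintegral integral_uniform_partial//.
    by move=> x; exact: test_function_derivable tchi.
  exact: test_function_continuous_partial tchi.
rewrite average_adjoint//.
under eq_Rintegral do rewrite E mulrBr.
under [in RHS]eq_Rintegral do rewrite mulrBl.
have fe2 := Lfun2_translation (- e) f2.
have i1 := Lfun2_integrableM f2 (Lfun2_test_function te).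
have i2 := Lfun2_integrableM f2 chi2.
have i3 := Lfun2_integrableM fe2 chi2.
rewrite RintegralB// RintegralB// opprB; congr (_ - _).
rewrite -[RHS](@Rintegral_translation R e); last first.
  exact: Lfun2_measurableM fe2 chi2.
by apply: eq_Rintegral => z _; rewrite addrK.
Qed.

Lemma weak_partialW Omega j f g :
  (forall chi, test_function setT chi ->
    \int[leb2 R]_z (f z * partial j chi z) = - \int[leb2 R]_z (g z * chi z)) ->
  weak_partial Omega j f g.
Proof.
move=> fg chi tchi; have [K [_ KO K0 dK0]] := test_function_support tchi.
have E (h k : R * R -> R) : (forall z, ~ K z -> k z = 0) ->
    \int[leb2 R]_(z in Omega) (h z * k z) = \int[leb2 R]_z (h z * k z).
  move=> k0; rewrite Rintegral_mkcond; apply: eq_Rintegral => z _.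
  rewrite patchE; case: ifPn => //; rewrite notin_setE => nO.
  by rewrite k0 ?mulr0// => /KO.
by rewrite (E f _ (dK0 j)) (E g _ K0); apply: fg; exact: test_function_setT tchi.
Qed.

(** [(u, v)] is divergence free, and [psi] is a stream function of its difference with the translate
    by [e]. As an average of [u] it is in L^2. *)
Lemma stream_function (u v : R * R -> R) :
  u \in Lfun (leb2 R) 2%:E -> v \in Lfun (leb2 R) 2%:E ->
  (forall chi, test_function setT chi ->
    \int[leb2 R]_z (u z * partial 0 chi z) = - \int[leb2 R]_z (v z * partial 1 chi z)) ->
  exists2 psi, psi \in Lfun (leb2 R) 2%:E & forall Omega,
    weak_partial Omega 1 psi (fun z => u z - u (z - basis2 R 1)) /\
    weak_partial Omega 0 psi (fun z => - (v z - v (z - basis2 R 1))).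
Proof.
move=> u2 v2 uv; set e := basis2 R 1.
exists (average U e u); first exact: Lfun2_average.
move=> Omega; split; apply: weak_partialW => chi tchi.
  exact: Rintegral_average_partial.
have dchi2 i := Lfun2_partial_test_function i tchi.
rewrite Rintegral_average_mul//.
(* The divergence condition is tested against the translate [chi(. + t e)] for each [t], which
   trades [u] and [partial 0] for [v] and [partial 1]; the average is then reassembled around
   [v]. *)
transitivity (\int[U]_t (-1 * \int[leb2 R]_z (v z * partial 1 chi (z + t *: e)))).
  apply: eq_Rintegral => t _; rewrite mulN1r.
  under eq_Rintegral do rewrite -partial_translation.
  rewrite uv; last exact: test_function_translation.
  by under eq_Rintegral do rewrite partial_translation.
rewrite RintegralZl//; last exact: integrable_correlation.
rewrite -Rintegral_average_mul// Rintegral_average_partial// mulN1r; congr (- _).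
have ve2 := Lfun2_translation (- e) v2.
have i1 := Lfun2_integrableM (Lfun2B v2 ve2) (Lfun2_test_function tchi).
rewrite -mulN1r -RintegralZl//; apply: eq_Rintegral => z _.
by rewrite mulN1r mulNr.
Qed.

(** Since [f] vanishes outside a ball, only the values of [g] on a half-plane receding to infinity
    matter, and by dominated convergence the integral of [g^2] over that half-plane tends to 0. *)
Lemma correlation_cvg0 j (M : R) f g :
  f \in Lfun (leb2 R) 2%:E -> g \in Lfun (leb2 R) 2%:E ->
  (forall z, M < `|z| -> f z = 0) ->
  \int[leb2 R]_z (g (z - basis2 R j *+ n) * f z) @[n --> \oo] --> 0.
Proof.
move=> f2 g2 f0.
pose c (z : plane) : R := if j == 0 then z.1 else z.2.
have mc : measurable_fun setT c.
  by rewrite /c; case: (j == 0); [exact: measurable_fst|exact: measurable_snd].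
pose D n : set plane := [set z | c z <= M - n%:R].
have mD n : measurable (D n).
  rewrite (_ : D n = setT `&` c @^-1` `]-oo, M - n%:R]%classic).
    exact: mc.
  by apply/seteqP; split => z; rewrite /D/= in_itv/= => // -[].
have pmul (w : R * R) n : (w *+ n).1 = w.1 *+ n /\ (w *+ n).2 = w.2 *+ n.
  by elim: n => [//|n [IH1 IH2]]; rewrite !mulrSr -IH1 -IH2.
have cn (z : R * R) n : c (z - basis2 R j *+ n) = c z - n%:R.
  have [p1 p2] := pmul (basis2 R j) n.
  by rewrite /c -[LHS]/(if j == 0 then z.1 - (_ *+ n).1 else z.2 - (_ *+ n).2) p1 p2
    /basis2; case: (j == 0).
have cM z : `|z| <= M -> c z <= M.
  rewrite prod_normE ge_max /c => /andP[z1 z2].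
  by case: ifP => _; exact: le_trans (ler_norm _) _.
pose g_ n := g \_ (D n).
have g_2 n : g_ n \in Lfun (leb2 R) 2%:E by exact: Lfun2_patch.
rewrite [X in X @ _ --> _](_ : _ =
    fun n => \int[leb2 R]_z (g_ n (z - basis2 R j *+ n) * f z)).
  apply: Rintegral_mul_cvg0 => //.
    by move=> n; exact: Lfun2_translation.
  rewrite [X in X @ _ --> _](_ : _ = fun n => \int[leb2 R]_z (g_ n z ^+ 2)).
    have mg2 n : measurable_fun (T := plane) setT (fun z => (g_ n z ^+ 2)%:E).
      by apply/measurable_EFinP/measurable_funX; exact: Lfun2_measurable (g_2 n).
    apply: (@fine_cvg _ _ _ _ (fun n => \int[leb2 R]_z (g_ n z ^+ 2)%:E)%E 0).
    rewrite -[X in _ --> X](@integral0 _ plane R (leb2 R) setT).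
    apply: (dominated_cvg measurableT mg2 _ _ (Lfun2_integrable_sq g2)) => //.
      (* A fixed [z] is outside [D n] as soon as [n > M - c z]. *)
      move=> z _; apply: cvg_near_cst; near=> n.
      rewrite /g_ patchE ifN ?expr0n// notin_setE /D/= => cz.
      have : (n%:R : R) <= M - c z by lra.
      apply/negP; rewrite -ltNge.
      by near: n; exact: nbhs_infty_gtr.
    move=> n z _; rewrite gee0_abs ?lee_fin ?sqr_ge0// /g_ patchE.
    by case: ifP => // _; rewrite expr0n/= sqr_ge0.
  apply/funext => n; apply: (@Rintegral_translation R _ (fun z => g_ n z ^+ 2)).
  by apply: measurable_funX; exact: Lfun2_measurable (g_2 n).
apply/funext => n; apply: eq_Rintegral => z _.
(* Where [f] does not vanish, [z - n e] lies in the half-plane [D n]. *)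
have [/cM zM|/f0 ->] := leP `|z| M; last by rewrite !mulr0.
by rewrite /g_ patchE mem_set// /D/= cn lerD2r.
Unshelve. all: by end_near. Qed.

End StreamFunction.

(** * Two-valued indices, and the integral of a partial derivative *)

Section TractionFree.
Variable R : realType.
Local Notation plane := (measurableTypeR R * measurableTypeR R)%type.
Implicit Types (x : R * R) (f g psi : R * R -> R) (Omega : set (R * R))
  (q S : R * R -> 'M[R]_2).

Lemma sum_ord2 (F : 'I_2 -> R) : \sum_i F i = F 0 + F 1.
Proof.
by rewrite !big_ord_recl big_ord0 addr0; congr (_ + F _); exact/val_inj.
Qed.

Lemma ord2_cases (i : 'I_2) : i = 0 \/ i = 1.
Proof. by case: i => [[|[|//]]] /= ?; [left|right]; exact/val_inj. Qed.

(** The derivative is integrated over [x] in the plane and along the segment from [x] to [x + e].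
    Segment first, this is the integral of [f(x + e) - f(x)], which is 0; plane first, translation
    invariance gives the integral of the derivative itself. *)
Lemma Rintegral_partial_eq0 j f : (forall x, derivable f x (basis2 R j)) ->
  continuous (partial j f) -> (leb2 R).-integrable setT (EFin \o f) ->
  (leb2 R).-integrable setT (EFin \o partial j f) ->
  \int[leb2 R]_x partial j f x = 0.
Proof.
move=> df cf if1 idf; set e := basis2 R j.
pose U := uniform_prob (@ltr01 R).
have iF := integrable_line U (- e) idf.
have mdf : measurable_fun (T := plane) setT (partial j f) 
  by apply/measurable_EFinP; exact: (measurable_int _ idf).
have E : (\int[leb2 R]_x \int[U]_t (partial j f (x - t *: - e))%:E =
  \int[U]_t \int[leb2 R]_x (partial j f (x - t *: - e))%:E)%E by exact: (Fubini iF).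
have ife := integrable_translation e if1.
transitivity (\int[leb2 R]_x (f (x + e) - f x)); last first.
  rewrite RintegralB// Rintegral_translation ?subrr//.
  by apply/measurable_EFinP; exact: (measurable_int _ if1).
have L x := integral_uniform_partial x df cf.
have Rr (t : R) : (\int[leb2 R]_x (partial j f (x - t *: - e))%:E =
    (\int[leb2 R]_x partial j f x)%:E)%E.
  have ift := integrable_translation (- (t *: - e)) idf.
  apply: (etrans (EFin_Rintegral (mu := leb2 R) (T := plane) ift)).
  apply: (congr1 EFin).
  exact: (@Rintegral_translation R (- (t *: - e)) (partial j f) mdf).
rewrite [RHS]/Rintegral; under [in RHS]eq_integral do rewrite -L.
rewrite E; under [in RHS]eq_integral do rewrite Rr.
rewrite (integral_cst U measurableT) [X in (_ * X)%E](probability_setT U).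
by rewrite mule1.
Qed.

End TractionFree.

(** * Divergence free tensors, cofactors and the traction condition *)

Section DivergenceFree.
Variable R : realType.
Local Notation plane := (measurableTypeR R * measurableTypeR R)%type.
Implicit Types (x v : R * R) (f g psi : R * R -> R) (Omega : set (R * R))
  (q S A B : R * R -> 'M[R]_2).

Lemma test_function_by_parts j psi chi :
  test_function setT psi -> test_function setT chi ->
  \int[leb2 R]_x (psi x * partial j chi x) = - \int[leb2 R]_x (partial j psi x * chi x).
Proof.
move=> tpsi tchi.
have psi2 := Lfun2_test_function tpsi; have chi2 := Lfun2_test_function tchi.
have dpsi2 := Lfun2_partial_test_function j tpsi.
have dchi2 := Lfun2_partial_test_function j tchi.
have dpsi x := @test_function_derivable _ _ _ j x tpsi.
have dchi x := @test_function_derivable _ _ _ j x tchi.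
have i1 := Lfun2_integrableM psi2 dchi2; have i2 := Lfun2_integrableM dpsi2 chi2.
apply/eqP; rewrite -addr_eq0 -RintegralD//; apply/eqP.
have E : partial j (psi * chi) =
    (fun x => psi x * partial j chi x + partial j psi x * chi x).
  apply/funext => x; rewrite /partial deriveM; [|exact: dpsi|exact: dchi].
  by congr (_ + _); rewrite [LHS]mulrC.
rewrite -E; apply: Rintegral_partial_eq0.
- by move=> x; apply: derivableM; [exact: dpsi|exact: dchi].
- rewrite E => x; apply: cvgD; apply: cvgM.
  + exact: test_function_continuous tpsi _.
  + exact: test_function_continuous_partial tchi _.
  + exact: test_function_continuous_partial tpsi _.
  + exact: test_function_continuous tchi _.
- exact: Lfun2_integrableM psi2 chi2.
- by rewrite E; exact: (integrableD measurableT i1 i2).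
Qed.

Definition L2_tensor A := forall i j, (fun x => A x i j) \in Lfun (leb2 R) 2%:E.

Definition dot A B x : R := \sum_i \sum_j A x i j * B x i j.

Lemma dotE A B x : dot A B x =
  A x 0 0 * B x 0 0 + A x 0 1 * B x 0 1 + (A x 1 0 * B x 1 0 + A x 1 1 * B x 1 1).
Proof. by rewrite /dot !sum_ord2. Qed.

Lemma integrable_dot A B : L2_tensor A -> L2_tensor B ->
  (leb2 R).-integrable setT (EFin \o dot A B) /\
  \int[leb2 R]_x dot A B x = \sum_i \sum_j \int[leb2 R]_x (A x i j * B x i j).
Proof.
move=> A2 B2.
have H i := Rintegral_sumr (fun j => Lfun2_integrableM (A2 i j) (B2 i j)).
have [H1 H2] := Rintegral_sumr (fun i => (H i).1).
by split; [exact: H1|rewrite H2; apply: eq_bigr => i _; exact: (H i).2].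
Qed.

Lemma traction_freeE Omega S (G : R * R -> 'M[R]_2) : (forall x, ~ Omega x -> S x = 0) ->
  \int[leb2 R]_(x in Omega) (\sum_i \sum_j S x i j * G x i j) = \int[leb2 R]_x dot S G x.
Proof.
move=> S0; rewrite Rintegral_mkcond; apply: eq_Rintegral => x _.
rewrite patchE; case: ifPn => //; rewrite notin_setE => nO.
by rewrite dotE S0// !mxE !mul0r !addr0.
Qed.

Lemma L2_restrict Omega f : measurable (Omega : set plane) ->
  f \in Lfun (leb2 R) 2%:E -> L2 Omega f.
Proof. exact: Lfun2_patch. Qed.

(** A test function of the whole plane restricts to an H^1 function on [Omega], even if its support
    crosses the boundary; the weak traction condition covers exactly such fields. *)
Lemma traction_free_div_free Omega S : open Omega -> L2_tensor S ->
  (forall x, ~ Omega x -> S x = 0) ->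
  traction_free_equilibrium Omega S -> div_free S.
Proof.
move=> oO S2 S0 tS i0 psi tpsi; have mO := open_measurable_plane oO.
(* A single nonzero component isolates row [i0] of the equilibrium equation. *)
pose phi x : 'rV[R]_2 := \row_i (if i == i0 then psi x else 0).
pose G x : 'M[R]_2 := \matrix_(i, j) (if i == i0 then partial j psi x else 0).
have f0 : (fun _ : R * R => 0 : R) \in Lfun (leb2 R) 2%:E.
  have /Lfun2Z := Lfun2_test_function tpsi => /(_ 0).
  by under eq_fun do rewrite mul0r.
have H1 : H1_with_gradient Omega phi G.
  move=> i; split.
    apply: L2_restrict => //; under eq_fun do rewrite mxE.
    by case: (i == i0) => //; exact: Lfun2_test_function tpsi.
  move=> j; split.
    apply: L2_restrict => //; under eq_fun do rewrite mxE.
    by case: (i == i0) => //; exact: Lfun2_partial_test_function tpsi.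
  apply: weak_partialW => chi tchi.
  under eq_Rintegral do rewrite mxE.
  under [in RHS]eq_Rintegral do rewrite mxE.
  case: (i == i0); first exact: test_function_by_parts.
  under eq_Rintegral do rewrite mul0r.
  under [in RHS]eq_Rintegral do rewrite mul0r.
  by rewrite Rintegral_cst// mul0r oppr0.
have := tS _ _ H1; rewrite traction_freeE// => I0; rewrite -[RHS]I0.
apply: eq_Rintegral => x _; rewrite /dot [RHS](bigD1 i0)//= [X in _ = _ + X]big1 ?addr0.
  by apply: eq_bigr => j _; rewrite mxE eqxx.
by move=> i /negbTE ni; rewrite big1// => j _; rewrite mxE ni mulr0.
Qed.

Lemma div_free_translation v q : L2_tensor q -> div_free q -> div_free (fun x => q (x + v)).
Proof.
move=> q2 dq i psi tpsi; have tv := test_function_translation (- v) tpsi.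
rewrite -[RHS](dq i _ tv) -[RHS](@Rintegral_translation R v).
  apply: eq_Rintegral => x _; apply: eq_bigr => j _.
  by rewrite partial_translation addrK.
have [iq _] := Rintegral_sumr (fun j =>
  Lfun2_integrableM (q2 i j) (Lfun2_partial_test_function j tv)).
by apply/measurable_EFinP; exact: (measurable_int _ iq).
Qed.

(** The cofactor matrix, linear in dimension 2. Each of its rows is the other row of [A] turned by a
    right angle, so rows of zero divergence become rows of zero curl. *)
Definition cof A x : 'M[R]_2 :=
  \matrix_(i, j) (if i == 0 then (if j == 0 then A x 1 1 else - A x 1 0)
                  else (if j == 0 then - A x 0 1 else A x 0 0)).

Lemma L2_cof A : L2_tensor A -> L2_tensor (cof A).
Proof.
move=> A2 i j; under eq_fun do rewrite mxE.
by case: (i == 0); case: (j == 0) => //; exact: Lfun2N.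
Qed.

Lemma L2_tensor_translation v A : L2_tensor A -> L2_tensor (fun x => A (x + v)).
Proof. by move=> A2 i j; exact: (Lfun2_translation v (A2 i j)). Qed.

(** Stream functions of the rows of [q - q(. - e)] form an H^1 field whose gradient is the cofactor
    matrix of that difference, so the traction condition applies to it. *)
Lemma dot_cof_translation Omega S q : open Omega -> L2_tensor S ->
  (forall x, ~ Omega x -> S x = 0) -> traction_free_equilibrium Omega S ->
  L2_tensor q -> div_free q ->
  \int[leb2 R]_x dot S (cof q) x =
  \int[leb2 R]_x dot S (cof (fun y => q (y - basis2 R 1))) x.
Proof.
move=> oO S2 S0 tS q2 dq; set e := basis2 R 1; have mO := open_measurable_plane oO.
have q0 i chi : test_function setT chi ->
    \int[leb2 R]_z (q z i 0 * partial 0 chi z) =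
    - \int[leb2 R]_z (q z i 1 * partial 1 chi z).
  move=> tchi; apply/eqP; rewrite -addr_eq0 -RintegralD//.
  - by rewrite -[X in _ == X](dq i _ tchi); apply/eqP/eq_Rintegral => z _; rewrite sum_ord2.
  - exact: Lfun2_integrableM (q2 i 0) (Lfun2_partial_test_function 0 tchi).
  - exact: Lfun2_integrableM (q2 i 1) (Lfun2_partial_test_function 1 tchi).
have [psi0 psi02 Hpsi0] := stream_function (q2 0 0) (q2 0 1) (q0 0).
(* The second row is negated so that [(psi1, psi0)] has the cofactor signs in its gradient. *)
have [|psi1 psi12 Hpsi1] := stream_function (Lfun2N (q2 1 0)) (Lfun2N (q2 1 1)).
  move=> chi tchi.
  under eq_Rintegral do rewrite mulNr -mulN1r.
  under [in RHS]eq_Rintegral do rewrite mulNr -mulN1r.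
  rewrite RintegralZl// ?RintegralZl// ?q0 ?mulrN//.
  - exact: Lfun2_integrableM (q2 1 1) (Lfun2_partial_test_function 1 tchi).
  - exact: Lfun2_integrableM (q2 1 0) (Lfun2_partial_test_function 0 tchi).
pose phi x : 'rV[R]_2 := \row_i (if i == 0 then psi1 x else psi0 x).
pose dq_ i j x := q x i j - q (x - e) i j.
have dq2 i j : dq_ i j \in Lfun (leb2 R) 2%:E.
  exact: Lfun2B (q2 i j) (L2_tensor_translation (- e) q2 i j).
pose G x := cof q x - cof (fun y => q (y - e)) x.
have G2 : L2_tensor G.
  move=> i j; under eq_fun do rewrite mxE [X in _ + X]mxE.
  apply: Lfun2B; first exact: L2_cof.
  exact: (L2_cof (L2_tensor_translation (- e) q2)).
have HG : H1_with_gradient Omega phi G.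
  move=> i; split.
    by apply: L2_restrict => //; under eq_fun do rewrite mxE; case: (i == 0).
  move=> j; split; first by apply: L2_restrict => //; exact: G2.
  have [w11 w10] := Hpsi1 Omega; have [w01 w00] := Hpsi0 Omega.
  rewrite (_ : (fun x => phi x 0 i) = if i == 0 then psi1 else psi0); last first.
    by apply/funext => x; rewrite mxE; case: (i == 0).
  case: (ord2_cases j) => ->; case: (eqVneq i 0) => i0.
  - move: w10; congr weak_partial; apply/funext => x.
    by rewrite !mxE i0/=; ring.
  - move: w00; congr weak_partial; apply/funext => x.
    by rewrite !mxE (negbTE i0)/=; ring.
  - move: w11; congr weak_partial; apply/funext => x.
    by rewrite !mxE i0/=; ring.
  - move: w01; congr weak_partial; apply/funext => x.
    by rewrite !mxE (negbTE i0)/=.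
have := tS _ _ HG; rewrite traction_freeE// => I0.
have [i1 _] := integrable_dot S2 (L2_cof q2).
have [i2 _] := integrable_dot S2 (L2_cof (L2_tensor_translation (- e) q2)).
apply/eqP; rewrite -subr_eq0 -RintegralB//; apply/eqP.
rewrite -[RHS]I0; apply: eq_Rintegral => x _; rewrite !dotE /G !mxE/=.
by ring.
Qed.

End DivergenceFree.

(** * Orthogonality relations and identification of the solenoidal part *)

Section SolenoidalPart.
Variable R : realType.
Local Notation plane := (measurableTypeR R * measurableTypeR R)%type.
Implicit Types (x v : R * R) (Omega : set (R * R))
  (q s S A B P : R * R -> 'M[R]_2).

(** The pairing of [S] with [cof (qn n)] is constant in [n] by repeated translation, and tends to 0
    as a combination of correlations of entries. *)
Lemma dot_cof_eq0 Omega S q : open Omega -> bounded_set Omega -> L2_tensor S ->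
  (forall x, ~ Omega x -> S x = 0) -> traction_free_equilibrium Omega S ->
  L2_tensor q -> div_free q -> \int[leb2 R]_x dot S (cof q) x = 0.
Proof.
move=> oO [M0 [_ OM]] S2 S0 tS q2 dq; set e := basis2 R 1.
pose qn n x := q (x - e *+ n).
have qn2 n : L2_tensor (qn n) by exact: L2_tensor_translation.
have E n : \int[leb2 R]_x dot S (cof q) x = \int[leb2 R]_x dot S (cof (qn n)) x.
  elim: n => [|n ->].
    by apply: eq_Rintegral => x _; rewrite /dot /cof /qn mulr0n subr0.
  rewrite (dot_cof_translation oO S2 S0 tS (qn2 n)); last exact: div_free_translation.
  apply: eq_Rintegral => x _; rewrite /dot /cof /qn mulrSr opprD addrA.
  by rewrite [x - _ - _]addrAC.
have S0' i j x : M0 + 1 < `|x| -> S x i j = 0.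
  move=> xM; rewrite S0 ?mxE// => Ox.
  have M01 : M0 < M0 + 1 by rewrite ltrDl.
  by have := OM _ M01 x Ox; rewrite /= leNgt xM.
have Sq i j k l : \int[leb2 R]_x (qn n x k l * S x i j) @[n --> \oo] --> 0.
  exact: (correlation_cvg0 1 (S2 i j) (q2 k l) (S0' i j)).
have : \int[leb2 R]_x dot S (cof (qn n)) x @[n --> \oo] --> 0.
  rewrite (_ : (fun n => _) = fun n => \sum_i \sum_j
      \int[leb2 R]_x (S x i j * cof (qn n) x i j)); last first.
    by apply/funext => n; have [] := integrable_dot S2 (L2_cof (qn2 n)).
  have SC i j : \int[leb2 R]_x (S x i j * cof (qn n) x i j) @[n --> \oo] --> 0.
    have N k l : \int[leb2 R]_x (S x i j * - qn n x k l) @[n --> \oo] --> 0.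
      rewrite (_ : (fun n => _) = fun n => - \int[leb2 R]_x (qn n x k l * S x i j)).
        by rewrite -oppr0; apply: cvgN; exact: Sq.
      apply/funext => n; rewrite -mulN1r -RintegralZl//.
        by apply: eq_Rintegral => x _; ring.
      exact: Lfun2_integrableM (qn2 n k l) (S2 i j).
    have Q k l : \int[leb2 R]_x (S x i j * qn n x k l) @[n --> \oo] --> 0.
      by under eq_fun do under eq_Rintegral do rewrite mulrC; exact: Sq.
    under eq_fun do under eq_Rintegral do rewrite mxE.
    by case: (i == 0); case: (j == 0); 
      [exact: (Q 1 1)|exact: (N 1 0)|exact: (N 0 1)|exact: (Q 0 0)].
  pose I i j n := \int[leb2 R]_x (S x i j * cof (qn n) x i j).
  have : (I 0 0 n + I 0 1 n) + (I 1 0 n + I 1 1 n) @[n --> \oo] --> (0 + 0) + (0 + 0).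
    by apply: cvgD; apply: cvgD; exact: SC.
  by rewrite !addr0; under [in X in _ -> X]eq_fun do rewrite !sum_ord2.
under eq_fun do rewrite -E.
move=> /cvg_lim => /(_ (@Rhausdorff R)) <-.
by rewrite lim_cst//; exact: Rhausdorff.
Qed.

Lemma L2_sym_grad (w : R * R -> 'rV[R]_2) : test_field w -> L2_tensor (sym_grad w).
Proof.
move=> tw i j; under eq_fun do rewrite mxE.
by apply: Lfun2Z; apply: Lfun2D; exact: Lfun2_partial_test_function.
Qed.

(** Against a symmetric [q] the symmetric gradient pairs like the full gradient, and row [i] of [q]
    is then tested with the component [w_i]. *)
Lemma dot_sym_grad_eq0 q (w : R * R -> 'rV[R]_2) : L2_tensor q ->
  (forall x, (q x)^T = q x) -> div_free q -> test_field w ->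
  \int[leb2 R]_x dot (sym_grad w) q x = 0.
Proof.
move=> q2 qT dq tw.
have q10 x : q x 1 0 = q x 0 1 by rewrite -[in LHS](qT x) mxE.
have H i := Rintegral_sumr (fun j => Lfun2_integrableM (q2 i j)
  (Lfun2_partial_test_function j (tw i))).
have [_] := Rintegral_sumr (fun i => (H i).1).
rewrite [RHS]big1 => [<-|i _]; last exact: dq.
apply: eq_Rintegral => x _; rewrite dotE !sum_ord2 !mxE q10.
by field.
Qed.

Lemma sqr_le_dot A i j x : A x i j ^+ 2 <= dot A A x.
Proof.
rewrite /dot (bigD1 i)//= (bigD1 j)//= -expr2 -addrA lerDl addr_ge0//.
  by apply: sumr_ge0 => k _; rewrite -expr2 sqr_ge0.
by apply: sumr_ge0 => k _; apply: sumr_ge0 => l _; rewrite -expr2 sqr_ge0.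
Qed.

(** The norm is the square root of the integral of [dot (D n) (D n)], which dominates the square of
    each entry. *)
Lemma L2_norm_cvg0 (D : nat -> R * R -> 'M[R]_2) : (forall n, L2_tensor (D n)) ->
  L2_norm (D n) @[n --> \oo] --> (0 : \bar R)%E ->
  forall i j, \int[leb2 R]_x (D n x i j ^+ 2) @[n --> \oo] --> 0.
Proof.
move=> D2 D0 i j.
pose a n := \int[leb2 R]_x dot (D n) (D n) x.
have a0 n : 0 <= a n.
  apply: Rintegral_ge0 => x _; rewrite dotE -!expr2.
  by rewrite !addr_ge0// sqr_ge0.
have NE n : L2_norm (D n) = (Num.sqrt (a n))%:E.
  have [iD _] := integrable_dot (D2 n) (D2 n).
  rewrite /L2_norm unlock.
  rewrite (_ : (\int[_]_x _)%E = (a n)%:E).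
    by rewrite poweR_EFin powR12_sqrt.
  rewrite /a [RHS](fineK (integrable_fin_num measurableT iD)); apply: eq_integral => x _.
  have d0 : 0 <= \sum_i0 \sum_j0 D n x i0 j0 ^+ 2.
    by apply: sumr_ge0 => k _; apply: sumr_ge0 => l _; exact: sqr_ge0.
  rewrite /= powR_mulrn// -normrX sqr_sqrtr// ger0_norm//.
have ca : a n @[n --> \oo] --> 0.
  have sa : Num.sqrt (a n) @[n --> \oo] --> 0.
    apply: (@fine_cvg _ _ _ _ (fun n => (Num.sqrt (a n))%:E) 0).
    by move: D0; rewrite (funext NE).
  rewrite -(mulr0 (0 : R)); under eq_fun do rewrite -(sqr_sqrtr (a0 _)) expr2.
  exact: cvgM.
apply: (@squeeze_cvgr _ _ _ _ (fun=> 0) a) => //; last exact: cvg_cst.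
apply: nearW => n; rewrite Rintegral_ge0 => [/=|x _]; last exact: sqr_ge0.
apply: le_Rintegral => //.
- exact: Lfun2_integrable_sq (D2 n i j).
- exact: (integrable_dot (D2 n) (D2 n)).1.
by move=> x _; exact: sqr_le_dot.
Qed.

Lemma L2_setT (f : R * R -> R) : L2 setT f -> f \in Lfun (leb2 R) 2%:E.
Proof.
by rewrite /L2 (_ : f \_ setT = f)//; apply/funext => x; rewrite patchE in_setT.
Qed.

(** As [q] is orthogonal to every [sym_grad (w n)], the pairing of [sym_grad (w n) - P] with [q]
    equals minus that of [P] with [q] for every [n], while it tends to 0. *)
Lemma dot_potential_eq0 q P : L2_tensor q -> (forall x, (q x)^T = q x) ->
  div_free q -> potential_tensor P -> \int[leb2 R]_x dot P q x = 0.
Proof.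
move=> q2 qT dq [[_ P2'] [w [tw wP]]].
have P2 : L2_tensor P by move=> i j; exact: L2_setT.
pose D n x := sym_grad (w n) x - P x.
have D2 n : L2_tensor (D n).
  move=> i j; under eq_fun do rewrite mxE [X in _ + X]mxE.
  exact: Lfun2B (L2_sym_grad (tw n) i j) (P2 i j).
have D0 := L2_norm_cvg0 D2 wP.
pose I i j n := \int[leb2 R]_x (D n x i j * q x i j).
have : (I 0 0 n + I 0 1 n) + (I 1 0 n + I 1 1 n) @[n --> \oo] --> (0 + 0) + (0 + 0).
  by apply: cvgD; apply: cvgD;
    exact: (Rintegral_mul_cvg0 (fun n => D2 n _ _) (q2 _ _) (D0 _ _)).
rewrite !addr0.
rewrite (_ : (fun n => _) = fun=> - \int[leb2 R]_x dot P q x).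
  move=> /cvg_lim => /(_ (@Rhausdorff R)); rewrite lim_cst; last exact: Rhausdorff.
  by move/eqP; rewrite oppr_eq0 => /eqP.
apply/funext => n; have [iD ID] := integrable_dot (D2 n) q2.
rewrite -[LHS](_ : \int[leb2 R]_x dot (D n) q x = _); last by rewrite ID !sum_ord2.
have [iw _] := integrable_dot (L2_sym_grad (tw n)) q2.
have [iP _] := integrable_dot P2 q2.
rewrite -[RHS]add0r -(dot_sym_grad_eq0 q2 qT dq (tw n)) -RintegralB//.
by apply: eq_Rintegral => x _; rewrite !dotE /D !mxE; ring.
Qed.

Lemma L2_dot_eq0 q : L2_tensor q -> \int[leb2 R]_x dot q q x = 0 ->
  forall i j, {ae leb2 R, forall x, q x i j = 0}.
Proof.
move=> q2 q0 i j; apply: (Lfun2_eq0 (q2 i j)); apply/eqP.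
rewrite eq_le; apply/andP; split; last first.
  by apply: Rintegral_ge0 => x _; exact: sqr_ge0.
rewrite -q0; apply: le_Rintegral => //.
- exact: Lfun2_integrable_sq (q2 i j).
- exact: (integrable_dot q2 q2).1.
by move=> x _; exact: sqr_le_dot.
Qed.

Lemma solenoidal_part_stress Omega S s eps (k m : R) :
  open Omega -> bounded_set Omega -> L2_tensor S -> (forall x, (S x)^T = S x) ->
  (forall x, ~ Omega x -> S x = 0) -> traction_free_equilibrium Omega S ->
  (forall x, eps x = k *: S x - (k * m) *: cof S x) ->
  solenoidal_part eps s -> {ae leb2 R, forall x, s x = k *: S x}.
Proof.
move=> oO bO S2 ST S0 tS epsE [[sT' s2'] ds [P [pP Ps]]].
have F : Filter (nbhs (almost_everywhere (leb2 R))).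
  exact: ae_filter_ringOfSetsType.
have s2 : L2_tensor s by move=> i j; exact: L2_setT.
have P2 : L2_tensor P by move=> i j; apply: L2_setT; case: pP => -[].
pose q x := s x - k *: S x.
have q2 : L2_tensor q.
  move=> i j; under eq_fun do rewrite !mxE.
  by apply: Lfun2B; [exact: s2|exact: Lfun2Z].
have qT x : (q x)^T = q x by rewrite linearB linearZ/= ST sT'.
have dS := traction_free_div_free oO S2 S0 tS.
have dq : div_free q.
  move=> i psi tpsi.
  have dp j := Lfun2_partial_test_function j tpsi.
  have [isig _] := Rintegral_sumr (fun j => Lfun2_integrableM (s2 i j) (dp j)).
  have [iS _] := Rintegral_sumr (fun j => Lfun2_integrableM (S2 i j) (dp j)).
  have : \int[leb2 R]_x (\sum_j s x i j * partial j psi x -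
      k * \sum_j S x i j * partial j psi x) = 0.
    rewrite RintegralB// ?RintegralZl// ?ds// ?dS// ?mulr0 ?subr0//.
    exact: (integrableZl measurableT k iS).
  move=> I0; rewrite -[RHS]I0; apply: eq_Rintegral => x _; rewrite !sum_ord2 /q !mxE.
  by ring.
have Iq : \int[leb2 R]_x dot q q x = 0.
  have [iC _] := integrable_dot S2 (L2_cof q2).
  have [iP _] := integrable_dot P2 q2.
  have [iq _] := integrable_dot q2 q2.
  have : \int[leb2 R]_x ((- (k * m)) * dot S (cof q) x - dot P q x) = 0.
    rewrite RintegralB// ?RintegralZl// ?(dot_cof_eq0 oO bO S2 S0 tS q2 dq).
      by rewrite (dot_potential_eq0 q2 qT dq pP) mulr0 subr0.
    exact: (integrableZl measurableT _ iC).
  move=> I0; rewrite -[RHS]I0; congr fine; apply: ae_eq_integral => //.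
  - exact: measurable_int _ iq.
  - exact: measurable_int _
      (integrableB measurableT (integrableZl measurableT (- (k * m)) iC) iP).
  (* What remains is pointwise algebra: [cof] is self-adjoint for [dot], and for symmetric [S] and
     [q] both pairings read [S11 q00 - 2 S01 q01 + S00 q11] (indices 0 and 1). *)
  apply: filterS Ps => x Psx _; congr EFin.
  have S10 : S x 1 0 = S x 0 1 by rewrite -[in LHS](ST x) mxE.
  have s10 : s x 1 0 = s x 0 1 by rewrite -[in LHS](sT' x I) mxE.
  have sE i j : s x i j = k * S x i j - k * m * cof S x i j - P x i j.
    have : (P x + s x) i j = (k *: S x - (k * m) *: cof S x) i j by rewrite -Psx epsE.
    by rewrite !mxE => <-; rewrite addrAC subrr add0r.
  have qE i j : q x i j = - (k * m) * cof S x i j - P x i j.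
    by rewrite {1}/q mxE [X in _ + X]mxE [X in _ - X]mxE sE; ring.
  have q10 : q x 1 0 = q x 0 1 by rewrite -[in LHS](qT x) mxE.
  have C00 : cof S x 0 0 = S x 1 1 by rewrite mxE.
  have C11 : cof S x 1 1 = S x 0 0 by rewrite mxE.
  have C01 : cof S x 0 1 = - S x 0 1 by rewrite mxE/= S10.
  have C10 : cof S x 1 0 = - S x 0 1 by rewrite mxE.
  have D00 : cof q x 0 0 = q x 1 1 by rewrite mxE.
  have D11 : cof q x 1 1 = q x 0 0 by rewrite mxE.
  have D01 : cof q x 0 1 = - q x 0 1 by rewrite mxE/= q10.
  have D10 : cof q x 1 0 = - q x 0 1 by rewrite mxE.
  rewrite !dotE D00 D11 D01 D10 S10 q10.
  have := qE 0 0; have := qE 0 1; have := qE 1 0; have := qE 1 1.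
  rewrite C00 C01 C10 C11 q10 => E11 E10 E01 E00.
  (* Only one factor of each square in [dot q q] is expressed through [S] and [P]; the other stays
     [q], to be paired with them. *)
  transitivity ((- (k * m) * S x 1 1 - P x 0 0) * q x 0 0 +
    (- (k * m) * - S x 0 1 - P x 0 1) * q x 0 1 +
    ((- (k * m) * - S x 0 1 - P x 1 0) * q x 0 1 +
     (- (k * m) * S x 0 0 - P x 1 1) * q x 1 1)).
    by rewrite -E00 -E01 -E10 -E11.
  by ring.
have q00 := L2_dot_eq0 q2 Iq.
near=> x.
have q0 : forall i j, q x i j = 0.
  move=> i j.
  by case: (ord2_cases i) => ->; case: (ord2_cases j) => ->; near: x; exact: q00.
apply/matrixP => i j; apply/eqP; rewrite -subr_eq0.
by have := q0 i j; rewrite {1}/q mxE [X in _ + X]mxE => ->.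
Unshelve. all: by end_near. Qed.

End SolenoidalPart.

(** * Inversion of Hooke's law and recovery of the strain *)

Section Recovery.
Variable R : realType.
Implicit Types (x : R * R) (Omega : set (R * R)) (eps s : R * R -> 'M[R]_2)
  (C : 'I_2 -> 'I_2 -> 'I_2 -> 'I_2 -> R).

(** Once [s = k S] almost everywhere, the compliance law reads [e = s - m cof s], whose entries are
    the three formulas. Keeping [C], [k] and [m] abstract treats both plane conditions at once. *)
Lemma strain_recovery C Omega eps s (k m : R) :
  (forall i j l n, C i j l n = C j i l n) ->
  (forall A x, (A x)^T = A x ->
    A x = k *: stress C A x - (k * m) *: cof (stress C A) x) ->
  open Omega -> bounded_set Omega -> L2_sym_tensor Omega eps ->
  traction_free_equilibrium Omega (stress C eps) ->
  solenoidal_part (ext0 Omega eps) s ->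
  {ae leb2 R, forall x,
     [/\ ext0 Omega eps x 0 0 = s x 0 0 - m * s x 1 1,
         ext0 Omega eps x 1 1 = s x 1 1 - m * s x 0 0 &
         ext0 Omega eps x 0 1 = (1 + m) * s x 0 1]}.
Proof.
move=> Csym compliance oO bO [epsT eps2] tS sol.
set e := ext0 Omega eps; pose S := stress C e.
have eO x : Omega x -> e x = eps x by move=> Ox; rewrite /e /ext0 /patch mem_set.
have e0 x : ~ Omega x -> e x = 0.
  by move=> nO; rewrite /e /ext0 /patch memNset.
have eT x : (e x)^T = e x.
  by have [/[dup] Ox /eO ->|/e0 ->] := pselect (Omega x); [exact: epsT|rewrite trmx0].
have e2 : L2_tensor e.
  move=> i j; rewrite (_ : (fun x => e x i j) = (fun x => eps x i j) \_ Omega).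
    exact: eps2.
  apply/funext => x; rewrite patchE; case: ifPn => [/set_mem/eO -> //|].
  by rewrite notin_setE => /e0 ->; rewrite mxE.
have S2 : L2_tensor S.
  move=> i j; under eq_fun do rewrite mxE !sum_ord2.
  by do 2 apply: Lfun2D; apply: Lfun2Z; exact: e2.
have ST x : (S x)^T = S x.
  apply/matrixP => i j; rewrite !mxE; apply: eq_bigr => l _; apply: eq_bigr => n _.
  by rewrite Csym.
have S0 x : ~ Omega x -> S x = 0.
  move=> /e0 ex; apply/matrixP => i j; rewrite !mxE.
  by rewrite big1// => l _; rewrite big1// => n _; rewrite ex mxE mulr0.
have tS' : traction_free_equilibrium Omega S.
  move=> phi G HG; rewrite -[RHS](tS phi G HG); apply: eq_Rintegral => x /set_mem Ox.
  apply: eq_bigr => i _; apply: eq_bigr => j _; congr (_ * _); rewrite !mxE.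
  by apply: eq_bigr => l _; apply: eq_bigr => n _; rewrite eO.
have F : Filter (nbhs (almost_everywhere (leb2 R))).
  exact: ae_filter_ringOfSetsType.
have eE x : e x = k *: S x - (k * m) *: cof S x by exact: compliance.
apply: filterS (solenoidal_part_stress oO bO S2 ST S0 tS' eE sol) => x sx.
have S10 : S x 1 0 = S x 0 1 by rewrite -[in LHS]ST mxE.
have eij i j : e x i j = k * S x i j - k * m * cof S x i j.
  by rewrite eE; move: (S x) (cof S x) => B D; rewrite !mxE.
have sij i j : s x i j = k * S x i j by rewrite sx; move: (S x) => B; rewrite mxE.
have [C00 C11 C01] : [/\ cof S x 0 0 = S x 1 1, cof S x 1 1 = S x 0 0 &
    cof S x 0 1 = - S x 0 1] by rewrite -S10 /cof; split; rewrite mxE.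
by split; rewrite eij !sij ?C00 ?C11 ?C01; ring.
Qed.

(** For a symmetric 2 by 2 stress [sigma], [cof sigma = tr(sigma) I - sigma], so this is the usual
    [E eps = (1 + nu) sigma - nu tr(sigma) I]. *)
Lemma plane_stress_compliance (E nu : R) (A : R * R -> 'M[R]_2) x :
  0 < E -> -1 < nu -> nu < 2^-1 -> (A x)^T = A x ->
  A x = E^-1 *: stress (plane_stress_C E nu) A x -
    (E^-1 * nu) *: cof (stress (plane_stress_C E nu) A) x.
Proof.
move=> E0 nu1 nu2 AT; have A10 : A x 1 0 = A x 0 1 by rewrite -[in LHS]AT mxE.
have En : E != 0 by rewrite gt_eqF.
have n1 : 1 + nu != 0 by rewrite gt_eqF//; lra.
have n2 : 1 - nu != 0 by rewrite gt_eqF//; lra.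
apply/matrixP => i j.
by case: (ord2_cases i) => ->; case: (ord2_cases j) => ->;
  rewrite !mxE/= !sum_ord2 /plane_stress_C/= A10; field; rewrite ?En ?n1 ?n2.
Qed.

(** Plane strain is plane stress with the effective constants [E / (1 - nu^2)] and
    [nu / (1 - nu)]. *)
Lemma plane_strain_compliance (E nu : R) (A : R * R -> 'M[R]_2) x :
  0 < E -> -1 < nu -> nu < 2^-1 -> (A x)^T = A x ->
  A x = ((1 - nu ^+ 2) / E) *: stress (plane_strain_C E nu) A x -
    ((1 - nu ^+ 2) / E * (nu / (1 - nu))) *: cof (stress (plane_strain_C E nu) A) x.
Proof.
move=> E0 nu1 nu2 AT; have A10 : A x 1 0 = A x 0 1 by rewrite -[in LHS]AT mxE.
have En : E != 0 by rewrite gt_eqF.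
have n1 : 1 + nu != 0 by rewrite gt_eqF//; lra.
have n2 : 1 - nu != 0 by rewrite gt_eqF//; lra.
have n3 : 1 - 2 * nu != 0 by rewrite gt_eqF//; lra.
apply/matrixP => i j.
by case: (ord2_cases i) => ->; case: (ord2_cases j) => ->;
  rewrite !mxE/= !sum_ord2 /plane_strain_C/= A10; field; rewrite ?En ?n1 ?n2 ?n3.
Qed.

End Recovery.

Theorem mainTheorem6 (R : realType) (E nu : R) (Omega : set (R * R))
    (eps s : R * R -> 'M[R]_2) :
  0 < E -> -1 < nu -> nu < 2^-1 ->
  lipschitz_sc_domain Omega ->
  L2_sym_tensor Omega eps ->
  solenoidal_part (ext0 Omega eps) s ->
  (traction_free_equilibrium Omega (stress (plane_strain_C E nu) eps) ->
   {ae leb2 R, forall x : R * R,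
     [/\ ext0 Omega eps x 0 0 = s x 0 0 - nu / (1 - nu) * s x 1 1,
         ext0 Omega eps x 1 1 = s x 1 1 - nu / (1 - nu) * s x 0 0 &
         ext0 Omega eps x 0 1 = 1 / (1 - nu) * s x 0 1]}) /\
  (traction_free_equilibrium Omega (stress (plane_stress_C E nu) eps) ->
   {ae leb2 R, forall x : R * R,
     [/\ ext0 Omega eps x 0 0 = s x 0 0 - nu * s x 1 1,
         ext0 Omega eps x 1 1 = s x 1 1 - nu * s x 0 0 &
         ext0 Omega eps x 0 1 = (1 + nu) * s x 0 1]}).
Proof.
move=> E0 nu1 nu2 [oO _ _ [bO _ _]] eps2 sol; split=> tS.
  (* This is the shear factor [1 + m] for [m = nu / (1 - nu)]. *)
  rewrite (_ : 1 / (1 - nu) = 1 + nu / (1 - nu)); last first.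
    by field; rewrite gt_eqF//; lra.
  apply: strain_recovery tS sol => //.
    by move=> i j l n; rewrite /plane_strain_C (eq_sym i j) addrC; ring.
  by move=> A x; exact: plane_strain_compliance.
apply: strain_recovery tS sol => //.
  by move=> i j l n; rewrite /plane_stress_C (eq_sym i j); ring.
by move=> A x; exact: plane_stress_compliance.
Qed.
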